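(* Fix $1\le p_0<\infty$ and $\mathbb B\in O(p_0,\infty)$. Let $f\in L^{p_0}_{loc}(\mathbb R^n)$ and let $a$ be a functional with $a\in D_\infty$ such that $(\fint_{2^kQ}|B_Qf|^{p_0}dx)^{1/p_0}\le a(2^kQ)$ for every integer $k\ge0$ and every cube $Q$. Set $\eta_1=1$, $\eta_k=\alpha_k$ for $k=2,3,4$ and $\eta_k=\max\{\alpha_k,\alpha_{k-3}\}$ for $k\ge5$. Then for every cube $Q$, $$\|B_Qf\|_{\exp L,Q}\le C\sum_{k\ge1}\eta_k\,a(2^kQ),$$ and, for every $w\in A_\infty$, $$\|B_Qf\|_{\exp L(w),Q}\le C_w\sum_{k\ge1}\eta_k\,a(2^kQ),$$ with $C,C_w$ independent of $Q$ and $f$.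
   Context: Cubes $Q=\prod_i[a_i,a_i+\ell(Q))$; $\lambda Q$ is the concentric cube of sidelength $\lambda\ell(Q)$; $\mathcal Q$ is the set of all cubes; $\fint_Eg=|E|^{-1}\int_Eg$. $\|g\|_{\exp L,Q}=\inf\{\lambda>0:\fint_Q(\exp(|g|/\lambda)-1)dx\le1\}$, and $\|g\|_{\exp L(w),Q}$ is defined the same way with $dx/|Q|$ replaced by $w\,dx/w(Q)$. $A_\infty$ is the union of the Muckenhoupt classes $A_p$. A functional is a map $a:\mathcal Q\to[0,\infty)$; $a\in D_\infty$ means there is $C\ge1$ with $a(R)\le Ca(Q)$ for all cubes $R\subset Q$. $\mathbb B=(B_Q)$ are linear operators on $L^{p_0}_{loc}(\mathbb R^n)$, $A_Q=I-B_Q$; $\mathbb B\in O(p_0,\infty)$ means: (a) $B_QB_R=B_RB_Q$ for all $Q,R$; (b) $\|B_Qf\|_{L^{p_0}(\mathbb R^n)}\le C_{p_0}\|f\|_{L^{p_0}(\mathbb R^n)}$ for all $Q$; (c) there are $\alpha_k\ge0$ ($k\ge2$) with $\sum_k2^{kn/p_0}\alpha_k<\infty$ such that $\operatorname{ess\,sup}_{2Q}|A_Q(f\chi_{4Q})|\le\alpha_2(\fint_{4Q}|f|^{p_0})^{1/p_0}$ and, for $j\ge1$, $\operatorname{ess\,sup}_{2^jQ}|A_Q(f\chi_{\mathbb R^n\setminus2^{j+1}Q})|\le\sum_{k\ge2}\alpha_{k+j}(\fint_{2^{k+j}Q}|f|^{p_0})^{1/p_0}$; (d) there are $\beta_k\ge0$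 with $\sum\beta_k<\infty$ such that for cubes $R\subset Q$, $\operatorname{ess\,sup}_{2R}|B_RA_Qf|\le\sum_{k\ge1}\beta_{k+1}(\fint_{2^{k+1}Q}|f|^{p_0})^{1/p_0}$. *)

(* Defs.v *)
(* R^n is modelled as [n.-tuple R] with its
   product sigma-algebra (library instance); Lebesgue measure is any
   measure [mu] giving every cube its volume. *)
From HB Require Import structures.
From mathcomp Require Import all_boot all_order all_algebra.
From mathcomp Require Import all_classical all_reals all_analysis.
Set Implicit Arguments. Unset Strict Implicit. Unset Printing Implicit Defensive.
Import Order.TTheory GRing.Theory Num.Theory. Import numFieldNormedType.Exports.
Local Open Scope classical_set_scope. Local Open Scope ring_scope.

Section defs.
Variables (R : realType) (n : nat).

Local Notation pt := (n.-tuple R).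

Record cube := Cube { corner : pt; side : R; side_gt0 : 0 < side }.

Definition cset (Q : cube) : set pt :=
  [set x | forall i : 'I_n, tnth (corner Q) i <= tnth x i < tnth (corner Q) i + side Q].

Definition vol (Q : cube) : R := side Q ^+ n.

Lemma dil_gt0 (k : nat) (Q : cube) : 0 < 2 ^+ k * side Q.
Proof. by rewrite mulr_gt0 ?exprn_gt0 ?side_gt0. Qed.

(* dil k Q = 2^k Q, the concentric cube of sidelength 2^k l(Q) *)
Definition dil (k : nat) (Q : cube) : cube :=
  @Cube [tuple tnth (corner Q) i - (2 ^+ k - 1) * side Q / 2 | i < n]
        (2 ^+ k * side Q) (dil_gt0 k Q).

Variable mu : {measure set pt -> \bar R}.

(* mu is (the Borel restriction of) Lebesgue measure on R^n *)
Definition is_lebesgue : Prop := forall Q : cube, mu (cset Q) = (vol Q)%:E.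

Definition avgp (p : R) (Q : cube) (g : pt -> R) : \bar R :=
  (((vol Q)^-1)%:E * \int[mu]_(x in cset Q) ((`|g x| `^ p)%:E)) `^ (p^-1).

Definition locLp (p : R) (f : pt -> R) : Prop :=
  measurable_fun setT f /\
  forall Q : cube, (\int[mu]_(x in cset Q) ((`|f x| `^ p)%:E) < +oo)%E.

Definition Lp (p : R) (f : pt -> R) : Prop :=
  measurable_fun setT f /\ (\int[mu]_x ((`|f x| `^ p)%:E) < +oo)%E.

Definition Lpnorm (p : R) (f : pt -> R) : \bar R :=
  (\int[mu]_x ((`|f x| `^ p)%:E)) `^ (p^-1).

Definition esssup_on (E : set pt) (g : pt -> R) : \bar R :=
  ereal_inf [set y : \bar R | {ae mu, forall x, E x -> ((`|g x|)%:E <= y)%E}].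

Definition op_family (p : R) (B : cube -> (pt -> R) -> (pt -> R)) : Prop :=
  forall Q : cube,
    (forall f, locLp p f -> locLp p (B Q f)) /\
    (forall f g, locLp p f -> locLp p g -> {ae mu, forall x, f x = g x} ->
       {ae mu, forall x, B Q f x = B Q g x}) /\
    (forall f g (c : R), locLp p f -> locLp p g ->
       {ae mu, forall x, B Q (fun y => f y + c * g y) x = B Q f x + c * B Q g x}).

Definition Aop (B : cube -> (pt -> R) -> (pt -> R)) (Q : cube) (f : pt -> R) : pt -> R :=
  fun x => f x - B Q f x.

Definition restr (f : pt -> R) (E : set pt) : pt -> R := fun x => f x * \1_E x.

Definition classO (p : R) (B : cube -> (pt -> R) -> (pt -> R))
    (alpha beta : nat -> R) : Prop :=
  op_family p B /\
  (forall Q Q' f, locLp p f -> {ae mu, forall x, B Q (B Q' f) x = B Q' (B Q f) x}) /\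
  (exists C : R, forall Q f, Lp p f -> (Lpnorm p (B Q f) <= C%:E * Lpnorm p f)%E) /\
  (forall k, 0 <= alpha k) /\
  (\sum_(2 <= k <oo) ((2 `^ (k%:R * n%:R / p) * alpha k)%:E) < +oo)%E /\
  (forall Q f, locLp p f ->
     (esssup_on (cset (dil 1 Q)) (Aop B Q (restr f (cset (dil 2 Q))))
        <= (alpha 2)%:E * avgp p (dil 2 Q) f)%E /\
     (forall j : nat, (1 <= j)%N ->
        (esssup_on (cset (dil j Q)) (Aop B Q (restr f (~` cset (dil j.+1 Q))))
          <= \sum_(2 <= k <oo) ((alpha (k + j))%:E * avgp p (dil (k + j) Q) f))%E)) /\
  (forall k, 0 <= beta k) /\
  (\sum_(1 <= k <oo) (beta k)%:E < +oo)%E /\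
  (forall Q Q' f, locLp p f -> cset Q' `<=` cset Q ->
     (esssup_on (cset (dil 1 Q')) (B Q' (Aop B Q f))
        <= \sum_(1 <= k <oo) ((beta k.+1)%:E * avgp p (dil k.+1 Q) f))%E).

Definition Dinf (D : R) (a : cube -> R) : Prop :=
  (forall Q, 0 <= a Q) /\ forall Q Q', cset Q' `<=` cset Q -> a Q' <= D * a Q.

Definition expLnorm (Q : cube) (g : pt -> R) : \bar R :=
  ereal_inf [set l%:E | l in [set l : R | 0 < l /\
     (((vol Q)^-1)%:E * \int[mu]_(x in cset Q) ((expR (`|g x| / l) - 1)%:E) <= 1)%E]].

Definition wmeas (w : pt -> R) (Q : cube) : \bar R := \int[mu]_(x in cset Q) (w x)%:E.

Definition expLwnorm (w : pt -> R) (Q : cube) (g : pt -> R) : \bar R :=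
  ereal_inf [set l%:E | l in [set l : R | 0 < l /\
     (((fine (wmeas w Q))^-1)%:E *
        \int[mu]_(x in cset Q) (((expR (`|g x| / l) - 1) * w x)%:E) <= 1)%E]].

Definition weight (w : pt -> R) : Prop :=
  measurable_fun setT w /\ (forall x, 0 <= w x) /\
  (forall Q, (wmeas w Q < +oo)%E) /\ {ae mu, forall x, 0 < w x}.

Definition Ap (p : R) (w : pt -> R) : Prop :=
  if p == 1 then
    exists K : R, forall Q, {ae mu, forall x, cset Q x ->
       (((vol Q)^-1)%:E * wmeas w Q <= (K * w x)%:E)%E}
  else
    exists K : R, forall Q,
      (((vol Q)^-1)%:E * wmeas w Q *
       (((vol Q)^-1)%:E * \int[mu]_(x in cset Q) ((w x `^ (- (p - 1)^-1))%:E))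
          `^ (p - 1) <= K%:E)%E.

Definition Ainf (w : pt -> R) : Prop :=
  weight w /\ exists p : R, 1 <= p /\ Ap p w.

End defs.

Definition eta_seq {R : realType} (alpha : nat -> R) (k : nat) : R :=
  if k == 1%N then 1
  else if (k <= 4)%N then alpha k
  else Num.max (alpha k) (alpha (k - 3)%N).

(* Main.v *)
Require Import Defs.
From HB Require Import structures.
From mathcomp Require Import all_boot all_order all_algebra.
From mathcomp Require Import all_classical all_reals all_analysis.
From mathcomp Require Import measurable_realfun ring lra.
Import Order.TTheory GRing.Theory Num.Theory. Import numFieldNormedType.Exports.
Set Implicit Arguments. Unset Strict Implicit. Unset Printing Implicit Defensive.
Local Open Scope classical_set_scope. Local Open Scope ring_scope.

(** A John-Nirenberg argument.  For cubes S inside Q, commutation gives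
    B_Q f = A_S (B_Q f) + B_S f - A_Q (B_S f), and (c) bounds both A-terms in
    L^oo by averages over dilates; D_oo moves every dilate that is larger than
    Q to a dilate of the initial cube Q0, at the cost of the shift by 3 in eta.
    Stop at the maximal dyadic S in Q for which the average of |B_Q f|^p over
    2S exceeds a large multiple of L, where L bounds the sum over Q0.  The
    stopped cubes fill at most half of Q (Vitali), B_Q f = O(L) off them
    (Lebesgue differentiation), and |B_Q f| <= |B_S f| + O(L) on each of them.
    The last inequality involves B_S f again, so the exponential integrals over
    all Q inside Q0 satisfy a contractive recursion, also for the measure w dx
    as soon as |E| <= |Q|/2 forces w(E) <= g w(Q) with g < 1. *)

(** * Cubes and their dilates *)

(** The recursion keeps [Q0] and [L] fixed because each use of [Dinf] costs a factor [D]. Comparing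
    every stopped cube with its parent would multiply these factors, while comparing each cube
    inside [Q0] directly with [Q0] pays [D] once, whatever the depth. The two A-terms draw on
    different information. Averages of B_S f are given by hypothesis on dilates of S only, so a
    dilate of Q has to be enclosed in a dilate of S. Averages of B_Q f over 2^k S no larger than Q
    are given by no hypothesis; they are read off the ancestors of S, which did not stop. A
    contractive inequality says nothing about integrals that may be infinite. It is therefore run on
    exponentials truncated at height N, with limiting bounds free of N, before N tends to infinity.
    Every constant is linear in [L], which is what turns the final scale into a multiple of the
    series. *)

Section geometry.
Variables (R : realType) (n : nat).
Implicit Types Q S : cube R n.

(** Inclusion read on the endpoints, so that inclusions between dilates are linear inequalities in
    each coordinate. *)
Definition csub S Q := forall i : 'I_n,
  tnth (corner Q) i <= tnth (corner S) i /\
  tnth (corner S) i + side S <= tnth (corner Q) i + side Q.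

Lemma csub_cset S Q : csub S Q -> cset S `<=` cset Q.
Proof.
move=> SQ x Sx i; have [l r] := SQ i; have /andP[l' r'] := Sx i.
by apply/andP; split; lra.
Qed.

Lemma csub_refl Q : csub Q Q. Proof. by move=> i; split. Qed.

Lemma csub_trans Q S T : csub S Q -> csub T S -> csub T Q.
Proof. by move=> SQ TS i; have [? ?] := SQ i; have [? ?] := TS i; split; lra. Qed.

Lemma tnth_dil k Q i :
  tnth (corner (dil k Q)) i = tnth (corner Q) i - (2 ^+ k - 1) * side Q / 2.
Proof. by rewrite tnth_mktuple. Qed.

Lemma exp2_ge1 k : 1 <= 2 ^+ k :> R.
Proof. by rewrite exprn_ege1 // ler1n. Qed.

Lemma csub_dil k S Q : csub S Q -> csub (dil k S) (dil k Q).
Proof.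
move=> SQ i; have [l r] := SQ i; rewrite !tnth_dil /=.
have P1 := exp2_ge1 k; set P := 2 ^+ k in P1 *.
have : 0 <= (P - 1) * (side Q - side S) by rewrite mulr_ge0//; lra.
by move=> h; split; lra.
Qed.

Lemma csub_dil_le j k Q : (j <= k)%N -> csub (dil j Q) (dil k Q).
Proof.
move=> jk i; rewrite !tnth_dil /=.
have : 2 ^+ j <= 2 ^+ k :> R by rewrite ler_weXn2l// ler1n.
move=> h; have Q0 := side_gt0 Q.
have : 0 <= (2 ^+ k - 2 ^+ j) * side Q by rewrite mulr_ge0 ?subr_ge0// ltW.
by move=> h'; split; lra.
Qed.

Lemma csub_dil_self k Q : csub Q (dil k Q).
Proof.
move=> i; rewrite tnth_dil /=; have Q0 := side_gt0 Q; have P1 := exp2_ge1 k.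
have : 0 <= (2 ^+ k - 1) * side Q by rewrite mulr_ge0 ?subr_ge0// ltW.
by move=> h; split; lra.
Qed.

(** The dilate of S has the sidelength of Q and its centre in Q, so it leaves Q by at most half a
    side. This is why the stopping condition is tested on doubled cells: the double of an ancestor
    contains the dilate of S of the ancestor's size. *)
Lemma csub_dil_ancestor k S Q : csub S Q -> side Q = 2 ^+ k * side S ->
  csub (dil k S) (dil 1 Q).
Proof.
move=> SQ e i; have [l r] := SQ i; have S0 := side_gt0 S.
by rewrite !tnth_dil /= expr1; split; lra.
Qed.

(** Information on B_S f lives on dilates of S; the dilate of Q is enclosed in one of twice its
    sidelength, and [csub_dil_descendant_dil] then returns to a dilate of Q. *)
Lemma csub_dil_descendant k m S Q : csub S Q -> side Q = 2 ^+ m * side S ->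
  csub (dil k Q) (dil (k + m).+1 S).
Proof.
move=> SQ e i; have [l r] := SQ i; have S0 := side_gt0 S.
rewrite !tnth_dil /= exprS exprD.
have P1 := exp2_ge1 k.
have : 0 <= (2 ^+ k - 1) * side Q.
  by rewrite mulr_ge0 ?subr_ge0// ltW// side_gt0.
rewrite -!mulrA [2 ^+ k * (2 ^+ m * _)]mulrA.
have -> : (2 * (2 ^+ k * 2 ^+ m) - 1) * (side S / 2) =
   2 ^+ k * (2 ^+ m * side S) - side S / 2 by lra.
by rewrite -!mulrA -!e; split; lra.
Qed.

Lemma csub_dil_descendant_dil k m S Q : csub S Q -> side Q = 2 ^+ m * side S ->
  csub (dil (k + m).+1 S) (dil k.+2 Q).
Proof.
move=> SQ e i; have [l r] := SQ i; have S0 := side_gt0 S.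
rewrite !tnth_dil /= !exprS exprD.
have P1 := exp2_ge1 k.
have : 0 <= (2 ^+ k - 1) * side Q.
  by rewrite mulr_ge0 ?subr_ge0// ltW// side_gt0.
have -> : (2 * (2 ^+ k * 2 ^+ m) - 1) * side S / 2 =
   2 ^+ k * (2 ^+ m * side S) - side S / 2 by lra.
have -> : 2 * (2 ^+ k * 2 ^+ m) * side S = 2 * (2 ^+ k * (2 ^+ m * side S)) by lra.
by rewrite -!e; split; lra.
Qed.

Lemma csub_dil_overshoot j m S Q : csub S Q -> side Q = 2 ^+ m * side S ->
  csub (dil (j + m) S) (dil j.+1 Q).
Proof.
move=> SQ e i; have [l r] := SQ i; have S0 := side_gt0 S.
rewrite !tnth_dil /= exprS exprD.
have : 0 <= (2 ^+ j - 1) * side Q.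
  by rewrite mulr_ge0 ?subr_ge0 ?exp2_ge1// ltW// side_gt0.
have -> : (2 ^+ j * 2 ^+ m - 1) * side S / 2 =
   (2 ^+ j * (2 ^+ m * side S) - side S) / 2 by lra.
have -> : 2 ^+ j * 2 ^+ m * side S = 2 ^+ j * (2 ^+ m * side S) by lra.
by rewrite -!e; split; lra.
Qed.

(** The Vitali factor 3, rounded up to the power of two 4. *)
Lemma csub_dil_meet S Q : side S <= side Q -> cset S `&` cset Q !=set0 ->
  csub S (dil 2 Q).
Proof.
move=> SQ [x [Sx Qx]] i; have /andP[l r] := Sx i; have /andP[l' r'] := Qx i.
have S0 := side_gt0 S.
by rewrite !tnth_dil /= expr2; split; lra.
Qed.

Lemma vol_gt0 Q : 0 < vol Q.
Proof. by rewrite exprn_gt0// side_gt0. Qed.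

Lemma vol_dil k Q : vol (dil k Q) = (2 ^+ n) ^+ k * vol Q.
Proof. by rewrite /vol /= exprMn exprAC. Qed.

Lemma measurable_cset Q : measurable (cset Q).
Proof.
rewrite (_ : cset Q = \bigcap_(i in setT) ((tnth (T:=R))^~ i @^-1`
   `[tnth (corner Q) i, tnth (corner Q) i + side Q[)).
  apply: fin_bigcap_measurable => // i _.
  by rewrite -[X in measurable X]setTI; apply: measurable_tnth => //; exact: measurable_itv.
apply/seteqP; split => x /= h i.
  by move=> _ /=; rewrite in_itv /=; exact: h.
by have := h i I; rewrite /= in_itv.
Qed.

End geometry.

(** * Local L^p averages and their comparison on nested cubes *)

Section averages.
Variables (R : realType) (n : nat) (mu : {measure set (n.-tuple R) -> \bar R}).
Implicit Types (Q S : cube R n) (g : n.-tuple R -> R).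

Lemma measurable_fun_powRn (D : set (n.-tuple R)) g p : measurable_fun setT g ->
  measurable_fun D (fun x => (`|g x| `^ p)%:E).
Proof.
move=> mg; apply: (@measurable_funS _ _ _ _ setT) => //.
apply/measurable_EFinP; apply: (@measurableT_comp _ _ _ _ _ _ (fun x => x `^ p)) => //.
exact: measurableT_comp.
Qed.

Lemma avgp_ge0 p Q g : (0 <= avgp mu p Q g)%E.
Proof. exact: poweR_ge0. Qed.

Lemma poweR_EFin_cancel (p : R) (x : \bar R) : 0 < p -> (0 <= x)%E ->
  ((x `^ p^-1) `^ p = x)%E.
Proof. by move=> p0 x0; rewrite -poweRrM mulVf ?gt_eqF// poweRe1. Qed.

Lemma avgp_leP p Q g (t : R) : 0 < p -> 0 <= t ->
  (avgp mu p Q g <= t%:E)%E <->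
  (\int[mu]_(x in cset Q) ((`|g x| `^ p)%:E) <= (t `^ p * vol Q)%:E)%E.
Proof.
move=> p0 t0.
have V0 := vol_gt0 Q.
set J := (\int[mu]_(x in _) _)%E.
have J0 : (0 <= J)%E by apply: integral_ge0 => x _; rewrite lee_fin powR_ge0.
have J0' : (0 <= ((vol Q)^-1)%:E * J)%E.
  by rewrite mule_ge0// lee_fin invr_ge0 ltW.
have -> : (J <= (t `^ p * vol Q)%:E)%E = (((vol Q)^-1)%:E * J <= (t `^ p)%:E)%E.
  by rewrite muleC lee_pdivrMr// EFinM.
split => h.
  rewrite -(@poweR_EFin_cancel p _ p0 J0') -poweR_EFin.
  apply: gt0_ler_poweR => //; first exact: ltW.
  - by rewrite in_itv /= poweR_ge0 leey.
  - by rewrite in_itv /= lee_fin t0 leey.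
rewrite /avgp -/J -(poweRe1 (x := t%:E)) ?lee_fin//.
rewrite -(divff (lt0r_neq0 p0)) poweRrM poweR_EFin.
apply: gt0_ler_poweR => //; first by rewrite invr_ge0 ltW.
- by rewrite in_itv /= J0' leey.
- by rewrite in_itv /= lee_fin powR_ge0 leey.
Qed.


(** The volumes differ by a factor at most 2^n, whose p-th root is again at most 2^n as p >= 1;
    discarding the root keeps p out of the constants. *)
Lemma avgp_csub p S Q g : 1 <= p -> measurable_fun setT g -> csub S Q ->
  side Q <= 2 * side S ->
  (avgp mu p S g <= (2 ^+ n)%:E * avgp mu p Q g)%E.
Proof.
move=> p1 mg SQ e.
have p0 : 0 < p by exact: lt_le_trans p1.
have K1 := exp2_ge1 R n.
have K0 : 0 < 2 ^+ n :> R by exact: lt_le_trans K1.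
have VQ : vol Q <= 2 ^+ n * vol S.
  rewrite -exprMn /vol; apply: lerXn2r; rewrite ?nnegrE//.
    by rewrite ltW ?side_gt0.
  by rewrite mulr_ge0 ?ltW ?side_gt0.
have := avgp_ge0 p Q g; case E : (avgp mu p Q g) => [u| |] // u0; last first.
  by rewrite gt0_muley ?lte_fin// leey.
rewrite lee_fin in u0.
rewrite -EFinM; apply/avgp_leP => //; first by rewrite mulr_ge0// ltW.
have : (avgp mu p Q g <= u%:E)%E by rewrite E.
move=> /avgp_leP - /(_ p0 u0) h.
have : (\int[mu]_(x in cset S) (`|g x| `^ p)%:E <= \int[mu]_(x in cset Q) (`|g x| `^ p)%:E)%E.
  apply: ge0_subset_integral.
  - exact: measurable_cset.
  - exact: measurable_cset.
  - exact: measurable_fun_powRn.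
  - by move=> x _; rewrite lee_fin powR_ge0.
  - exact: csub_cset.
move=> /le_trans; apply; apply: (le_trans h); rewrite lee_fin.
rewrite powRM ?(ltW K0)//.
apply: (@le_trans _ _ (u `^ p * (2 ^+ n * vol S))).
  by rewrite ler_wpM2l// powR_ge0.
rewrite mulrCA mulrA; apply: ler_wpM2r; first by rewrite ltW// vol_gt0.
apply: ler_wpM2r; first exact: powR_ge0.
by rewrite -{1}[2 ^+ n]powRr1 ?(ltW K0)// ler_powR.
Qed.

End averages.

(** * Dyadic cells and differentiation along them *)

Section countable_families.
Context d (T : measurableType d) (R : realType) (mu : {measure set T -> \bar R}).
Variables (I : countType) (P : set I) (F : I -> set T).
Hypothesis mF : forall i, P i -> measurable (F i).

(** The family renumbered by [nat] along [pickle]: each [G k] is one member, or empty when [k] codes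
    no index in [P]. *)
Let G k := \bigcup_(i in [set i | P i /\ pickle i = k]) F i.

Let GP k : (exists i, [/\ P i, pickle i = k & G k = F i]) \/ G k = set0.
Proof.
have [[i [Pi ik]]|h] := pselect (exists i, P i /\ pickle i = k).
  left; exists i; split => //; apply/seteqP; split => [x [j [Pj jk] Fx]|x Fx].
    by have <- : j = i by apply: (pcan_inj pickleK); rewrite jk.
  by exists i.
by right; apply/seteqP; split => // x [i Pi _]; apply: h; exists i.
Qed.

Let G_bigcup : \bigcup_(i in P) F i = \bigcup_k G k.
Proof.
apply/seteqP; split => [x [i Pi Fx]|x [k _ [i [Pi _] Fx]]]; last by exists i.
by exists (pickle i) => //; exists i.
Qed.

Let mG k : measurable (G k).
Proof. by have [[i [Pi _ ->]]|->] := GP k => //; exact: mF. Qed.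

Lemma countable_bigcup_measurable : measurable (\bigcup_(i in P) F i).
Proof. by rewrite G_bigcup; exact: bigcupT_measurable. Qed.

(** Continuity from below. It reduces the covering estimate to finite lists of cubes, which can be
    sorted by size. *)
Lemma measure_bigcup_le_finite (c : \bar R) :
  (forall s : seq I, {in s, forall i, P i} ->
     (mu (\big[setU/set0]_(i <- s) F i) <= c)%E) ->
  (mu (\bigcup_(i in P) F i) <= c)%E.
Proof.
move=> h; rewrite G_bigcup -bigcup_bigsetU_bigcup.
set E := fun N => \big[setU/set0]_(k < N.+1) G k.
have mE N : measurable (E N) by apply: bigsetU_measurable.
have cvgE : mu (E N) @[N --> \oo] --> mu (\bigcup_N E N).
  apply: nondecreasing_cvg_mu => //; first exact: bigcupT_measurable.
  by move=> a b ab; apply/subsetPset; apply: subset_bigsetU.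
apply: (cvge_to_le cvgE).
apply: nearW => N; rewrite /E.
have [s Ps ->] : exists2 s : seq I, {in s, forall i, P i} &
    \big[setU/set0]_(k < N.+1) G k = \big[setU/set0]_(i <- s) F i.
  elim: N.+1 => [|M [s Ps e]].
    by exists [::] => //; rewrite big_ord0 big_nil.
  have [[i [Pi _ Gi]]|G0] := GP M.
    exists (i :: s); last by rewrite big_cons big_ord_recr /= e Gi setUC.
    by move=> j; rewrite inE => /orP[/eqP ->//|/Ps].
  by exists s => //; rewrite big_ord_recr /= G0 setU0.
exact: h.
Qed.

Hypothesis tF : trivIset P F.

Let tG : trivIset setT G.
Proof.
move=> a b _ _ [x [[i [Pi <-] Fi] [j [Pj <-] Fj]]].
by congr pickle; apply: tF => //; exists x.
Qed.

Lemma integral_le_pieces (u v : T -> \bar R) :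
  measurable_fun (\bigcup_(i in P) F i) u -> measurable_fun (\bigcup_(i in P) F i) v ->
  (forall x, 0 <= u x)%E -> (forall x, 0 <= v x)%E ->
  (forall i, P i -> (\int[mu]_(x in F i) u x <= \int[mu]_(x in F i) v x)%E) ->
  (\int[mu]_(x in \bigcup_(i in P) F i) u x <=
   \int[mu]_(x in \bigcup_(i in P) F i) v x)%E.
Proof.
rewrite G_bigcup => mu_ mv u0 v0 h.
rewrite !ge0_integral_bigcup//.
apply: lee_nneseries => k _; first by move=> _; apply: integral_ge0.
by have [[i [Pi _ ->]]|->] := GP k; [exact: h | rewrite !integral_set0].
Qed.

End countable_families.

Section dyadic.
Variables (R : realType) (n : nat).
Implicit Types (Q : cube R n) (x : n.-tuple R).

Lemma cell_side_gt0 Q m : 0 < side Q / 2 ^+ m.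
Proof. by rewrite divr_gt0 ?exprn_gt0 ?side_gt0. Qed.

(** The index is any tuple of naturals, so a cell may lie outside Q; the relevant cells are those
    that [idx] assigns to a point of Q. *)
Definition cell Q m (k : n.-tuple nat) : cube R n :=
  @Cube _ _ [tuple tnth (corner Q) i + (tnth k i)%:R * (side Q / 2 ^+ m) | i < n]
    (side Q / 2 ^+ m) (cell_side_gt0 Q m).

Lemma tnth_cell Q m k i : tnth (corner (cell Q m k)) i =
  tnth (corner Q) i + (tnth k i)%:R * (side Q / 2 ^+ m).
Proof. by rewrite tnth_mktuple. Qed.

Definition idx Q m x : n.-tuple nat :=
  [tuple Num.truncn ((tnth x i - tnth (corner Q) i) / (side Q / 2 ^+ m)) | i < n].

Let idx_arg_ge0 Q m x i : cset Q x ->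
  0 <= (tnth x i - tnth (corner Q) i) / (side Q / 2 ^+ m).
Proof.
move=> Qx; apply: divr_ge0; last exact: ltW (cell_side_gt0 Q m).
by have /andP[? ?] := Qx i; lra.
Qed.

Lemma mem_cell Q m k x : cset Q x -> cset (cell Q m k) x <-> idx Q m x = k.
Proof.
move=> Qx; split => [h|<- i].
  apply: eq_from_tnth => i; rewrite tnth_mktuple; apply/eqP.
  rewrite truncn_eq ?idx_arg_ge0// ler_pdivlMr ?ltr_pdivrMr ?cell_side_gt0//.
  have /= := h i; rewrite tnth_mktuple => /andP[? ?].
  by rewrite -natr1; apply/andP; split; lra.
have := truncn_itv (idx_arg_ge0 m i Qx).
rewrite ler_pdivlMr ?ltr_pdivrMr ?cell_side_gt0// => /andP[].
by rewrite /= !tnth_mktuple -natr1 => ? ?; apply/andP; split; lra.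
Qed.

Lemma mem_cell_idx Q m x : cset Q x -> cset (cell Q m (idx Q m x)) x.
Proof. by move=> Qx; apply/mem_cell. Qed.

Lemma truncn_divn (y : R) d : 0 <= y -> (0 < d)%N ->
  Num.truncn (y / d%:R) = (Num.truncn y %/ d)%N.
Proof.
move=> y0 d0; have d0' : 0 < d%:R :> R by rewrite ltr0n.
apply/eqP; rewrite truncn_eq ?divr_ge0// ler_pdivlMr ?ltr_pdivrMr// -!natrM.
have /andP[l r] := truncn_itv y0.
apply/andP; split; first by apply: le_trans l; rewrite ler_nat leq_trunc_div.
by apply: (lt_le_trans r); rewrite ler_nat ltn_ceil.
Qed.

(** Going up m generations is integer division by 2^m, which makes nestedness of the grids an
    arithmetic fact about naturals. *)
Lemma idx_divn Q j m x i : cset Q x ->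
  tnth (idx Q j x) i = (tnth (idx Q (j + m) x) i %/ 2 ^ m)%N.
Proof.
move=> Qx; rewrite !tnth_mktuple -truncn_divn ?idx_arg_ge0 ?expn_gt0//.
congr Num.truncn; rewrite natrX exprD.
have ? : 2 ^+ m != 0 :> R by rewrite expf_neq0.
have ? : 2 ^+ j != 0 :> R by rewrite expf_neq0.
have ? : side Q != 0 by rewrite gt_eqF ?side_gt0.
by field; rewrite ?mulf_neq0//; apply/and3P; split.
Qed.

Lemma idx_coarse Q j m x y : (j <= m)%N -> cset Q x -> cset Q y ->
  idx Q m x = idx Q m y -> idx Q j x = idx Q j y.
Proof.
move=> jm Qx Qy e; apply: eq_from_tnth => i.
by rewrite !(@idx_divn Q j (m - j)) // subnKC// e.
Qed.

Lemma side_cell Q j m k k' :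
  side (cell Q j k) = 2 ^+ m * side (cell Q (j + m) k').
Proof.
rewrite /= exprD.
have ? : 2 ^+ m != 0 :> R by rewrite expf_neq0.
have ? : 2 ^+ j != 0 :> R by rewrite expf_neq0.
by field; apply/andP; split.
Qed.

Lemma csub_cell_cell Q j m x : cset Q x ->
  csub (cell Q (j + m) (idx Q (j + m) x)) (cell Q j (idx Q j x)).
Proof.
move=> Qx i; set k := idx Q (j + m) x; set k' := idx Q j x.
rewrite !tnth_cell; have := side_cell Q j m k' k; rewrite /= => e.
rewrite e /k' (idx_divn _ m i Qx) -/k.
set h := side Q / 2 ^+ (j + m).
have h0 : 0 < h by exact: cell_side_gt0.
set t := tnth k i.
have l : (t %/ 2 ^ m * 2 ^ m <= t)%N by rewrite leq_trunc_div.
have r : (t.+1 <= (t %/ 2 ^ m).+1 * 2 ^ m)%N by rewrite ltn_ceil// expn_gt0.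
have {l}l : (t %/ 2 ^ m)%:R * 2 ^+ m <= t%:R :> R.
  by rewrite -natrX -natrM ler_nat.
have {r}r : t%:R + 1 <= ((t %/ 2 ^ m)%:R + 1) * 2 ^+ m :> R.
  by rewrite -natrX !natr1 -natrM ler_nat.
have := ler_wpM2r (ltW h0) l; have := ler_wpM2r (ltW h0) r.
by move=> ? ?; split; lra.
Qed.

Lemma cell0_side Q k : side (cell Q 0 k) = side Q.
Proof. by rewrite /= expr0 divr1. Qed.

Lemma side_cell_root Q m k : side Q = 2 ^+ m * side (cell Q m k).
Proof. by rewrite -(cell0_side Q k) (side_cell Q 0 m k k). Qed.

Lemma csub_cell Q m x : cset Q x -> csub (cell Q m (idx Q m x)) Q.
Proof.
move=> Qx; apply: (@csub_trans _ _ _ (cell Q 0 (idx Q 0 x))); last first.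
  exact: (@csub_cell_cell Q 0 m).
move=> i; rewrite cell0_side /= !tnth_mktuple expr0 !divr1.
suff -> : Num.truncn ((tnth x i - tnth (corner Q) i) / side Q) = 0%N.
  by rewrite mul0r addr0.
apply/eqP; have Q0 := side_gt0 Q.
have /andP[? ?] := Qx i.
by rewrite truncn_eq ?ler_pdivlMr ?ltr_pdivrMr ?divr_ge0//; lra.
Qed.

Lemma cell_side_small Q (e : R) : 0 < e -> exists m, side Q / 2 ^+ m <= e.
Proof.
move=> e0; pose N := (Num.truncn (side Q / e)).+1; exists N.
rewrite ler_pdivrMr ?exprn_gt0// mulrC -ler_pdivrMr//.
apply: (@le_trans _ _ N%:R); first exact/ltW/truncnS_gt.
by rewrite -natrX ler_nat ltnW// ltn_expl.
Qed.

End dyadic.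

(** * Approximation of Borel sets by dyadic cells, and differentiation *)

Section saturated_approximation.
Variables (R : realType) (n : nat) (mu : {measure set (n.-tuple R) -> \bar R}).
Hypothesis lmu : is_lebesgue mu.
Variable Q : cube R n.
Implicit Types (A U : set (n.-tuple R)) (x : n.-tuple R).

(** Inside Q, U is a union of cells of generation m; outside Q it is arbitrary. *)
Definition saturated m U := forall x y, cset Q x -> cset Q y ->
  idx Q m x = idx Q m y -> U x -> U y.

(* Borel sets are, inside Q, limits in measure of unions of dyadic cells: the
   substitute for density of dyadic step functions in L^1. *)
Definition dyadic_approx A := measurable A /\ forall e : R, 0 < e ->
  exists m U, [/\ measurable U, saturated m U &
    (mu (cset Q `&` (A `\` U `|` U `\` A)) <= e%:E)%E].

Let mQ := measurable_cset Q.

Lemma dyadic_approxC A : dyadic_approx A -> dyadic_approx (~` A).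
Proof.
move=> [mA h]; split; first exact: measurableC.
move=> e /h [m [U [mU sU le]]]; exists m, (~` U); split.
- exact: measurableC.
- by move=> x y Qx Qy xy nUx Uy; apply: nUx; apply: sU Uy.
- by move: le; rewrite !setDE !setCK setUC setIC [~` A `&` U]setIC [cset Q `&` _]setIC [A `&` _]setIC.
Qed.

Lemma saturated_le m m' U : (m <= m')%N -> saturated m U -> saturated m' U.
Proof. by move=> mm sU x y Qx Qy xy; apply: sU => //; exact: idx_coarse xy. Qed.

Lemma dyadic_approxU A A' : dyadic_approx A -> dyadic_approx A' ->
  dyadic_approx (A `|` A').
Proof.
move=> [mA h] [mA' h']; split; first exact: measurableU.
move=> e e0; have e2 : 0 < e / 2 by rewrite divr_gt0.
have [m [U [mU sU le]]] := h _ e2.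
have [m' [U' [mU' sU' le']]] := h' _ e2.
exists (maxn m m'), (U `|` U'); split; first exact: measurableU.
- move=> x y Qx Qy xy [Ux|Ux].
    by left; apply: (saturated_le _ sU) xy Ux => //; exact: leq_maxl.
  by right; apply: (saturated_le _ sU') xy Ux => //; exact: leq_maxr.
- have mD B V : measurable B -> measurable V ->
      measurable (cset Q `&` (B `\` V `|` V `\` B)).
    by move=> mB mV; apply: measurableI => //; apply: measurableU; exact: measurableD.
  rewrite [e]splitr EFinD; apply: le_trans (leeD le le').
  apply: le_trans (measureU2 _ (mD _ _ mA mU) (mD _ _ mA' mU')).
  apply: le_measure; rewrite ?inE.
  + by apply: mD; exact: measurableU.
  + by apply: measurableU; exact: mD.
  + move=> x [Qx [[[Ax|Ax] nU]|[[Ux|Ux] nA]]].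
    * by left; split => //; left; split => // ?; apply: nU; left.
    * by right; split => //; left; split => // ?; apply: nU; right.
    * by left; split => //; right; split => // ?; apply: nA; left.
    * by right; split => //; right; split => // ?; apply: nA; right.
Qed.

Lemma dyadic_approx0 : dyadic_approx set0.
Proof.
split; first exact: measurable0.
move=> e e0; exists 0%N, set0; split => //.
by rewrite set0D setU0 setI0 measure0 lee_fin ltW.
Qed.

(** Finite partial unions are approximable by induction. The remainders inside Q decrease to the
    empty set and Q has finite measure, so one of them has measure at most e/2. *)
Lemma dyadic_approx_bigcup (F : (set (n.-tuple R))^nat) :
  (forall k, dyadic_approx (F k)) -> dyadic_approx (\bigcup_k F k).
Proof.
move=> aF; have mF k : measurable (F k) by have [] := aF k.
have mUF : measurable (\bigcup_k F k) by exact: bigcupT_measurable.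
split => // e e0; have e2 : 0 < e / 2 by rewrite divr_gt0.
pose E N := \big[setU/set0]_(k < N) F k.
have aE N : dyadic_approx (E N).
  rewrite /E; elim: N => [|N IH]; first by rewrite big_ord0; exact: dyadic_approx0.
  by rewrite big_ord_recr /=; exact: dyadic_approxU.
have mE N : measurable (E N) by have [] := aE N.
pose D N := cset Q `&` (\bigcup_k F k `\` E N).
have mD N : measurable (D N) by apply: measurableI => //; exact: measurableD.
have [N le1] : exists N, (mu (D N) <= (e / 2)%:E)%E.
  apply: contrapT => /forallNP h.
  have cvgD : mu (D N) @[N --> \oo] --> mu (\bigcap_N D N).
    apply: nonincreasing_cvg_mu => //.
    - apply: (@le_lt_trans _ _ (mu (cset Q))); last by rewrite lmu ltry.
      by apply: le_measure; rewrite ?inE//; exact: subIsetl.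
    - exact: bigcapT_measurable.
    - move=> a b ab; apply/subsetPset; apply: setIS; apply: setDS.
      exact: subset_bigsetU.
  have : ((e / 2)%:E <= mu (\bigcap_N D N))%E.
    by apply: (cvge_to_ge cvgD); apply: nearW => N; rewrite leNgt; apply/negP => /ltW /h.
  rewrite (_ : \bigcap_N D N = set0) ?measure0 ?lee_fin ?leNgt ?e2//.
  apply/seteqP; split => // x Dx.
  have [_ [[k _ Fx] _]] := Dx 0%N I.
  have [_ [_]] := Dx k.+1 I; apply.
  by rewrite /E -bigcup_mkord; exists k => /=.
have [m [U [mU sU le2]]] := (aE N).2 _ e2.
exists m, U; split => //.
have mX : measurable (cset Q `&` (E N `\` U `|` U `\` E N)).
  by apply: measurableI => //; apply: measurableU; exact: measurableD.
rewrite [e]splitr EFinD; apply: le_trans (leeD le1 le2).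
apply: le_trans (measureU2 _ (mD N) mX).
apply: le_measure; rewrite ?inE.
- by apply: measurableI => //; apply: measurableU; exact: measurableD.
- exact: measurableU.
- have EF : E N `<=` \bigcup_k F k.
    by rewrite /E -bigcup_mkord => x [k _ Fk]; exists k.
  move=> x [Qx [[Fx nU]|[Ux nF]]]; last first.
    by right; split => //; right; split => // /EF.
  have [Ex|nE] := pselect (E N x); last by left.
  by right; split => //; left.
Qed.

(** A ray ending at a grid point is saturated, hence approximated without error. A general ray is
    the union over m of the rays ending at the last grid point of generation m not beyond r; a ray
    ending at or before the corner misses Q. *)
Lemma dyadic_approx_ray i (r : R) : dyadic_approx [set x | tnth x i < r].
Proof.
have mray (t : R) : measurable [set x : n.-tuple R | tnth x i < t].
  rewrite (_ : [set x | _] = (tnth (T:=R))^~ i @^-1` `]-oo, t[).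
    rewrite -[X in measurable X]setTI.
    by apply: measurable_tnth => //; exact: measurable_itv.
  by apply/seteqP; split => x /=; rewrite in_itv.
set c := tnth (corner Q) i.
have grid m k : dyadic_approx [set x | tnth x i < c + k%:R * (side Q / 2 ^+ m)].
  split; first exact: mray.
  move=> e e0; exists m, [set x | tnth x i < c + k%:R * (side Q / 2 ^+ m)]; split => //.
    move=> x y Qx Qy xy /=.
    have h0 := cell_side_gt0 Q m.
    have E z : cset Q z -> (tnth z i < c + k%:R * (side Q / 2 ^+ m)) =
        (tnth (idx Q m z) i < k)%N.
      move=> Qz; rewrite tnth_mktuple truncn_lt_nat ?ltr_pdivrMr//.
        by rewrite ltrBlDl.
      by apply: divr_ge0; [have /andP[] := Qz i; rewrite subr_ge0 | exact: ltW].
    by rewrite !E// xy.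
  by rewrite setDv setU0 setI0 measure0 lee_fin ltW.
pose k m := Num.truncn ((r - c) / (side Q / 2 ^+ m)).
have [rc|cr] := leP r c.
  split; first exact: mray.
  move=> e e0; exists 0%N, set0; split => //.
  rewrite set0D setU0 setD0 (_ : _ `&` _ = set0) ?measure0 ?lee_fin ?ltW//.
  apply/seteqP; split => // x [Qx /= xr]; have /andP[] := Qx i.
  by rewrite -/c => cx _; move: (le_lt_trans cx xr); rewrite ltNge rc.
have kP m : c + (k m)%:R * (side Q / 2 ^+ m) <= r < c + (k m).+1%:R * (side Q / 2 ^+ m).
  have h0 := cell_side_gt0 Q m.
  have : 0 <= (r - c) / (side Q / 2 ^+ m) by rewrite divr_ge0 ?ltW// subr_gt0.
  move=> /truncn_itv; rewrite -/(k m) ler_pdivlMr// ltr_pdivrMr// => /andP[? ?].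
  by apply/andP; split; lra.
rewrite (_ : [set x | _] =
  \bigcup_m [set x | tnth x i < c + (k m)%:R * (side Q / 2 ^+ m)]).
  by apply: dyadic_approx_bigcup => m; exact: grid.
apply/seteqP; split => [x /= xr|x [m _ /= xk]]; last first.
  by apply: (lt_le_trans xk); have /andP[] := kP m.
have d0 : 0 < r - tnth x i by rewrite subr_gt0.
have [m hm] := cell_side_small Q d0; exists m => //=.
have /andP[_] := kP m; rewrite -natr1; lra.
Qed.

(** The approximable sets form a sigma-algebra, and the coordinate rays generate the product
    sigma-algebra. *)
Lemma measurable_dyadic_approx A : measurable A -> dyadic_approx A.
Proof.
have sa : sigma_algebra setT dyadic_approx.
  split; [exact: dyadic_approx0 | | exact: dyadic_approx_bigcup].
  by move=> B; rewrite setTD; exact: dyadic_approxC.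
apply: smallest_sub => //.
rewrite -bigcup_seq => B [i _ [C mC <-]]; rewrite setTI.
suff : measurable `<=` [set C : set R | dyadic_approx ((tnth (T:=R))^~ i @^-1` C)].
  exact.
rewrite [X in X `<=` _](RGenInftyO.measurableE R); apply: smallest_sub.
  split.
  - by rewrite /= preimage_set0; exact: dyadic_approx0.
  - by move=> D aD; rewrite /= setTD preimage_setC; exact: dyadic_approxC.
  - by move=> F aF; rewrite /= preimage_bigcup; exact: dyadic_approx_bigcup.
move=> D [r ->] /=; have := dyadic_approx_ray i r; congr dyadic_approx.
Qed.

Lemma fin_mu_sub A : measurable A -> A `<=` cset Q -> mu A \is a fin_num.
Proof.
move=> mA AQ; rewrite ge0_fin_numE//; apply: (@le_lt_trans _ _ (mu (cset Q))).
  by apply: le_measure; rewrite ?inE.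
by rewrite lmu ltry.
Qed.

Lemma trivIset_cell m (P : set (n.-tuple nat)) :
  (forall k, P k -> cset (cell Q m k) `<=` cset Q) ->
  trivIset P (fun k => cset (cell Q m k)).
Proof.
move=> PQ k k' Pk Pk' [x [kx k'x]].
have Qx := PQ _ Pk _ kx.
by move/(mem_cell m k Qx): kx => <-; move/(mem_cell m k' Qx): k'x => <-.
Qed.

(** Lebesgue differentiation in contrapositive form. If a union V of cells equals A up to measure e,
    then c' |A n V| <= int_V g <= c |V|, hence (c' - c) |A| <= (c + c') e for every e > 0. *)
Lemma null_of_small_averages (g : n.-tuple R -> \bar R) (c c' : R) A :
  measurable_fun setT g -> (forall x, 0 <= g x)%E -> 0 <= c -> c < c' ->
  measurable A -> A `<=` cset Q -> (forall x, A x -> c'%:E <= g x)%E ->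
  (forall x m, A x -> (\int[mu]_(y in cset (cell Q m (idx Q m x))) g y
     <= (c * vol (cell Q m (idx Q m x)))%:E)%E) ->
  mu A = 0.
Proof.
move=> mg g0 c0 cc' mA AQ c'g avg.
have fA := fin_mu_sub mA AQ.
have c'0 : 0 < c' by exact: le_lt_trans cc'.
suff h : forall e : R, 0 < e -> (c' - c) * fine (mu A) <= (c + c') * e.
  have a0 : 0 <= fine (mu A) by rewrite fine_ge0.
  rewrite -(fineK fA); congr EFin; apply/eqP; rewrite eq_le a0 andbT.
  rewrite leNgt; apply/negP => a1.
  have := h ((c' - c) * fine (mu A) / (c + c') / 2).
  have k0 : 0 < (c' - c) * fine (mu A) by rewrite mulr_gt0// subr_gt0.
  have k1 : 0 < c + c' by lra.
  rewrite !divr_gt0// => /(_ isT).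
  rewrite mulrA [(c + c') * _]mulrC divfK ?gt_eqF//; lra.
move=> e e0.
have [m [U [mU sU le]]] := (measurable_dyadic_approx mA).2 _ e0.
(* Only cells containing a point of A are kept, since the bound on averages is assumed at points of
   A; by saturation they stay inside U and still cover the part of A in U. *)
pose P := [set k | exists x, [/\ A x, U x & idx Q m x = k]].
have PQ k : P k -> cset (cell Q m k) `<=` cset Q.
  by move=> [x [Ax _ <-]]; apply: csub_cset; apply: csub_cell; exact: AQ.
pose V := \bigcup_(k in P) cset (cell Q m k).
have mV : measurable V.
  by apply: countable_bigcup_measurable => k _; exact: measurable_cset.
have VQ : V `<=` cset Q by move=> x [k /PQ]; exact.
have VU : V `<=` U.
  move=> x [k Pk kx]; have Qx := PQ _ Pk _ kx.
  have [y [Ay Uy yk]] := Pk; apply: sU Uy => //; first exact: AQ.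
  by move/(mem_cell m k Qx): kx => ->.
have AUV : A `&` U `<=` V.
  by move=> x [Ax Ux]; exists (idx Q m x); [exists x | apply: mem_cell_idx; exact: AQ].
have mE : measurable (cset Q `&` (A `\` U `|` U `\` A)).
  by apply: measurableI => //; apply: measurableU; exact: measurableD.
have mAV : measurable (A `&` V) by exact: measurableI.
have leV : (mu V <= mu A + e%:E)%E.
  apply: le_trans (leeD (lexx _) le); apply: le_trans (measureU2 _ mA mE).
  apply: le_measure; rewrite ?inE//; first exact: measurableU.
  move=> x Vx; have [Ax|nA] := pselect (A x); [by left|right].
  by split; [exact: VQ | right; split => //; exact: VU].
have leA : (mu A <= mu (A `&` V) + e%:E)%E.
  apply: le_trans (leeD (lexx _) le); apply: le_trans (measureU2 _ mAV mE).
  apply: le_measure; rewrite ?inE//; first exact: measurableU.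
  move=> x Ax; have [Vx|nV] := pselect (V x); [by left|right].
  by split; [exact: AQ | left; split => // Ux; exact: nV (AUV _ _)].
have leI : (c'%:E * mu (A `&` V) <= c%:E * mu V)%E.
  rewrite -!integral_cst//.
  apply: (@le_trans _ _ (\int[mu]_(x in A `&` V) g x)%E).
    apply: ge0_le_integral => //.
    - by move=> x _; rewrite lee_fin ltW.
    - exact: measurable_funTS.
    - by move=> x [Ax _]; exact: c'g.
  apply: (@le_trans _ _ (\int[mu]_(x in V) g x)%E).
    apply: ge0_subset_integral => //; first exact: measurable_funTS.
  apply: integral_le_pieces => //.
  - by move=> k _; exact: measurable_cset.
  - exact: trivIset_cell.
  - exact: measurable_funTS.
  - by move=> k [x [Ax _ <-]]; rewrite integral_cst ?lmu//; [exact: avg | exact: measurable_cset].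
have fV := fin_mu_sub mV VQ.
have fAV : mu (A `&` V) \is a fin_num by apply: fin_mu_sub => // x [/AQ].
move: leV leA leI; rewrite -(fineK fA) -(fineK fV) -(fineK fAV).
rewrite -!EFinD -!EFinM !lee_fin => leV leA leI.
have := ler_wpM2l (ltW c'0) leA; have := ler_wpM2l c0 leV.
by rewrite /= !mulrDr mulrBl mulrDl; lra.
Qed.

End saturated_approximation.

(** * Covering, stopping and oscillation bounds *)

Section vitali.
Variables (R : realType) (n : nat).

Lemma cset_corner (Q : cube R n) : cset Q (corner Q).
Proof. by move=> i; rewrite lexx ltrDl side_gt0. Qed.

(** Greedy selection. On a list sorted by increasing side the induction decides the head last, after
    all cubes at least as large; a head that meets a selected cube is absorbed by it, otherwise it
    is selected. *)
Lemma vitali_seq (I : eqType) (C : I -> cube R n) (s : seq I) :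
  exists s' : seq I, [/\ {subset s' <= s}, uniq s',
    trivIset [set` s'] (fun i => cset (C i)) &
    forall i, i \in s -> exists2 j, j \in s' & csub (C i) (dil 2 (C j))].
Proof.
pose r i j := side (C i) <= side (C j).
have rT : total r by move=> i j; exact: le_total.
have rt : transitive r by move=> j i k; exact: le_trans.
suff H (u : seq I) : sorted r u -> exists s' : seq I, [/\ {subset s' <= u}, uniq s',
    trivIset [set` s'] (fun i => cset (C i)) &
    forall i, i \in u -> exists2 j, j \in s' & csub (C i) (dil 2 (C j))].
  have [s' [h1 h2 h3 h4]] := H _ (sort_sorted rT s); exists s'; split => //.
  - by move=> i /h1; rewrite mem_sort.
  - by move=> i; rewrite -(mem_sort r) => /h4.
elim: u => [_|x u IH /= pu].
  by exists [::]; split => //; move=> i j.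
have [s' [h1 h2 h3 h4]] := IH (path_sorted pu).
have xle j : j \in u -> r x j by move: j; apply/allP; exact: order_path_min pu.
have [[j js' xj]|nmeet] :=
  pselect (exists2 j, j \in s' & cset (C x) `&` cset (C j) !=set0).
  exists s'; split => //; first by move=> i /h1; rewrite inE orbC => ->.
  move=> i; rewrite inE => /orP[/eqP ->|/h4//].
  by exists j => //; apply: csub_dil_meet => //; apply: xle; exact: h1.
exists (x :: s'); split.
- by move=> i; rewrite !inE => /orP[->//|/h1 ->]; rewrite orbT.
- rewrite /= h2 andbT; apply/negP => xs'; apply: nmeet; exists x => //.
  by exists (corner (C x)); split; exact: cset_corner.
- move=> i j /=; rewrite !inE => /orP[/eqP ->|is'] /orP[/eqP ->|js'] // ij.
  + by exfalso; apply: nmeet; exists j.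
  + by exfalso; apply: nmeet; exists i => //; rewrite setIC.
  + exact: h3.
- move=> i; rewrite inE => /orP[/eqP ->|/h4 [j js' ij]].
    by exists x; rewrite ?mem_head//; exact: csub_dil_self.
  by exists j => //; rewrite inE js' orbT.
Qed.

Variable mu : {measure set (n.-tuple R) -> \bar R}.
Hypothesis lmu : is_lebesgue mu.

Lemma measure_bigsetU_le (I : Type) (s : seq I) (F : I -> set (n.-tuple R)) :
  (forall i, measurable (F i)) ->
  (mu (\big[setU/set0]_(i <- s) F i) <= \sum_(i <- s) mu (F i))%E.
Proof.
move=> mF; elim: s => [|i s IH]; first by rewrite !big_nil measure0.
rewrite !big_cons; apply: (le_trans (measureU2 _ _ _)) => //.
  exact: bigsetU_measurable.
exact: leeD.
Qed.

(** Selection is made among the doubles, because the integrals over the doubles have to be summed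
    disjointly. Each cube then lies in 8 times a selected one, whence (2^n)^3. *)
Lemma weak_type (I : countType) (P : set I) (C : I -> cube R n)
    (E : set (n.-tuple R)) (g : n.-tuple R -> \bar R) (t : R) :
  0 < t -> measurable E -> measurable_fun setT g -> (forall x, 0 <= g x)%E ->
  (forall i, P i -> cset (dil 1 (C i)) `<=` E) ->
  (forall i, P i -> ((t * vol (C i))%:E <= \int[mu]_(x in cset (dil 1 (C i))) g x)%E) ->
  (mu (\bigcup_(i in P) cset (C i)) <= ((2 ^+ n) ^+ 3 / t)%:E * \int[mu]_(x in E) g x)%E.
Proof.
move=> t0 mE mg g0 CE Ct; apply: measure_bigcup_le_finite.
  by move=> i _; exact: measurable_cset.
move=> s sP.
have [s' [ss us ts cs]] := vitali_seq (fun i => dil 1 (C i)) s.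
have K0 : 0 <= (2 ^+ n) ^+ 3 / t by rewrite divr_ge0 ?exprn_ge0// ltW.
have mc (Q : cube R n) : measurable (cset Q) by exact: measurable_cset.
apply: (@le_trans _ _ (mu (\big[setU/set0]_(i <- s') cset (dil 2 (dil 1 (C i)))))).
  apply: le_measure; rewrite ?inE//; try exact: bigsetU_measurable.
  rewrite -!bigcup_seq => x [i /= /cs [j js ij] xi]; exists j => //.
  by apply: (csub_cset ij); apply: (csub_cset (csub_dil_self 1 (C i))).
apply: (le_trans (measure_bigsetU_le _ _)) => //.
apply: (@le_trans _ _ (\sum_(i <- s')
   (((2 ^+ n) ^+ 3 / t)%:E * \int[mu]_(x in cset (dil 1 (C i))) g x))%E).
  rewrite !big_seq; apply: lee_sum => i is'.
  have Pi : P i by apply: sP; exact: ss.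
  apply: (@le_trans _ _ (((2 ^+ n) ^+ 3 / t)%:E * (t * vol (C i))%:E)%E).
    rewrite lmu !vol_dil -EFinM lee_fin.
    by rewrite [leRHS]mulrA divfK ?gt_eqF// mulrA -exprD.
  by apply: lee_wpmul2l => //; exact: Ct.
rewrite -ge0_sume_distrr; last by move=> i _; exact: integral_ge0.
apply: lee_wpmul2l => //.
rewrite -ge0_integral_bigsetU//; last exact: measurable_funTS.
apply: ge0_subset_integral => //; first exact: bigsetU_measurable.
  exact: measurable_funTS.
by rewrite -bigcup_seq => x [i /= is' xi]; apply: CE xi; apply: sP; exact: ss.
Qed.

End vitali.

(** * Maximal bad dyadic cells *)

Section stopping.
Variables (R : realType) (n : nat) (Q : cube R n).
Variable bad : nat -> n.-tuple nat -> Prop.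

(** A maximal bad cell, witnessed by a point for which it is the first bad cell. Recording
    generation and index, rather than the cube, keeps the family in a countable type. *)
Definition stopped : set (nat * n.-tuple nat) :=
  [set c | exists x, [/\ cset Q x, idx Q c.1 x = c.2, bad c.1 c.2 &
    forall j, (j < c.1)%N -> ~ bad j (idx Q j x)]].

Lemma csub_stopped c : stopped c -> csub (cell Q c.1 c.2) Q.
Proof. by move=> [x [Qx <- _ _]]; exact: csub_cell. Qed.

(** Dyadic cells that meet are nested; a strictly coarser one would be a bad ancestor of the finer,
    against the choice of the finer as a first bad cell. *)
Lemma trivIset_stopped : trivIset stopped (fun c => cset (cell Q c.1 c.2)).
Proof.
suff H c c' : stopped c -> stopped c' ->
    cset (cell Q c.1 c.2) `&` cset (cell Q c'.1 c'.2) !=set0 -> (c'.1 <= c.1)%N.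
  move=> c c' Sc Sc' cc'.
  have e : c.1 = c'.1.
    by apply/eqP; rewrite eqn_leq !H//; rewrite setIC.
  move: cc' => [y [cy c'y]].
  have Qy : cset Q y by apply: csub_cset cy; exact: csub_stopped.
  move/(mem_cell _ _ Qy): cy; move/(mem_cell _ _ Qy): c'y.
  by case: c e {Sc} => m k /= ->; case: c' {Sc'} => m' k' /= -> ->.
move=> Sc [x' [Qx' ik' _ nb]] [y [cy c'y]].
have Qy : cset Q y by apply: csub_cset cy; exact: csub_stopped.
move/(mem_cell _ _ Qy): cy => cy; move/(mem_cell _ _ Qy): c'y => c'y.
have [x [Qx ik b _]] := Sc.
rewrite leqNgt; apply/negP => lt; apply: (nb _ lt).
rewrite (@idx_coarse _ _ Q c.1 c'.1 x' y) ?cy//; first exact: ltnW.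
by rewrite ik' c'y.
Qed.

Lemma not_stopped x m : cset Q x ->
  ~ (\bigcup_(c in stopped) cset (cell Q c.1 c.2)) x -> ~ bad m (idx Q m x).
Proof.
move=> Qx nS; have [k] := ubnP m; elim: k m => // k IH m mk b.
apply: nS; exists (m, idx Q m x); last exact: mem_cell_idx.
by exists x; split => // j jm; apply: IH; apply: leq_trans jm _.
Qed.

End stopping.

(** * Pointwise bounds for [Aop] and the two series of averages *)

Section operators.
Variables (R : realType) (n : nat) (mu : {measure set (n.-tuple R) -> \bar R}).
Variables (p : R) (B : cube R n -> (n.-tuple R -> R) -> (n.-tuple R -> R)).
Variables (alpha beta : nat -> R).
Hypothesis p1 : 1 <= p.
Hypothesis BO : classO mu p B alpha beta.

(** Strictness provides an admissible bound below y without asking that the infimum be attained; it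
    accounts for the strict hypotheses below. *)
Lemma esssup_on_lt E (g : n.-tuple R -> R) (y : R) :
  (esssup_on mu E g < y%:E)%E -> {ae mu, forall x, E x -> `|g x| <= y}.
Proof.
move=> /ereal_inf_lt [z + zy].
apply: filterS => x h /h; move: zy; case: z {h} => [z| |] //=.
by rewrite lte_fin !lee_fin => zy /le_trans; apply; exact: ltW.
Qed.

Lemma nneseries_shift (u : nat -> \bar R) j k m : (forall i, 0 <= u i)%E ->
  (m <= j + k)%N ->
  (\sum_(j <= i <oo) u (i + k)%N <= \sum_(m <= i <oo) u i)%E.
Proof.
move=> u0 mjk; rewrite -(nneseries_addn j) => [|i]; last exact: u0.
under eq_eseriesr do rewrite -addnA.
rewrite nneseries_addn// -(subnKC mjk) (nneseries_split m (j + k - m)) //.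
by rewrite leeDr// sume_ge0.
Qed.

Lemma nneseries_term (u : nat -> \bar R) m k : (forall i, 0 <= u i)%E ->
  (m <= k)%N -> (u k <= \sum_(m <= i <oo) u i)%E.
Proof.
move=> u0 mk; apply: le_trans (nneseries_lim_ge k.+1 _); last by move=> *; exact: u0.
by rewrite big_nat_recr//= leeDr// sume_ge0.
Qed.

Lemma lee_nneseries_from (u v : nat -> \bar R) m :
  (forall i, 0 <= u i)%E -> (forall i, 0 <= v i)%E ->
  (forall i, (m <= i)%N -> u i <= v i)%E ->
  (\sum_(m <= i <oo) u i <= \sum_(m <= i <oo) v i)%E.
Proof.
move=> u0 v0 uv; rewrite -(nneseries_addn m u0) -(nneseries_addn m v0).
by apply: lee_nneseries => // i _; apply: uv; rewrite leq_addl.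
Qed.

Let p0 : 0 < p. Proof. exact: lt_le_trans p1. Qed.

Lemma locLp_restr f (E : set (n.-tuple R)) : measurable E -> locLp mu p f ->
  locLp mu p (restr f E).
Proof.
move=> mE [mf lf]; have mr : measurable_fun setT (restr f E).
  by apply: measurable_funM => //; exact: measurable_indic.
split; first exact: mr.
move=> Q; apply: le_lt_trans (lf Q).
apply: (@ge0_le_integral _ _ _ mu (cset Q)).
- exact: measurable_cset.
- by move=> x _; rewrite lee_fin powR_ge0.
- exact: measurable_fun_powRn.
- exact: measurable_fun_powRn.
- move=> x _; rewrite lee_fin; apply: ge0_ler_powR; rewrite ?nnegrE//; first exact: ltW.
  rewrite /restr indicE; case: (x \in E); rewrite ?mulr1 ?mulr0 ?normr0//.
Qed.

(** Splitting g at 4Q, condition (c) bounds the near part by the term k = 2 and the far part, with j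
    = 1, by the later terms. Each is at most the whole series, hence 2. *)
Lemma Aop_le Q g (H : R) : locLp mu p g ->
  (\sum_(2 <= k <oo) ((alpha k)%:E * avgp mu p (dil k Q) g) < H%:E)%E ->
  {ae mu, forall x, cset (dil 1 Q) x -> `|Aop B Q g x| <= 2 * H}.
Proof.
have [opB [_ [_ [a0 [_ [hc _]]]]]] := BO => lg lH.
pose u k := ((alpha k)%:E * avgp mu p (dil k Q) g)%E.
have u0 k : (0 <= u k)%E by rewrite mule_ge0 ?avgp_ge0// lee_fin.
set E := cset (dil 2 Q).
have mE : measurable E by exact: measurable_cset.
have l1 : locLp mu p (restr g E) by exact: locLp_restr.
have l2 : locLp mu p (restr g (~` E)) by apply: locLp_restr => //; exact: measurableC.
have [near far] := hc Q g lg.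
have near' := @esssup_on_lt _ _ H (le_lt_trans (le_trans near (@nneseries_term u 2 2 u0 (leqnn _))) lH).
have far' := @esssup_on_lt _ _ H
  (le_lt_trans (le_trans (far 1%N isT) (@nneseries_shift u 2 1 2 u0 isT)) lH).
have lin := (opB Q).2.2 _ _ 1 l1 l2.
have e : (fun y => restr g E y + 1 * restr g (~` E) y) = g.
  apply/funext => y; rewrite /restr !indicE in_setC; case: (y \in E); rewrite /=; ring.
rewrite e in lin.
apply: filterS3 near' far' lin => x h1 h2 h3 Qx.
have {h1} := h1 Qx; have {h2} := h2 Qx; rewrite /Aop h3 => h2 h1.
rewrite -{1}e.
have -> : restr g E x + 1 * restr g (~` E) x -
   (B Q (restr g E) x + 1 * B Q (restr g (~` cset (dil 2 Q))) x) =
   (restr g E x - B Q (restr g E) x) +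
   (restr g (~` E) x - B Q (restr g (~` E)) x) by rewrite /E; ring.
by apply: le_trans (ler_normD _ _) _; rewrite mulr_natl mulr2n lerD.
Qed.

Lemma B_diff_le S Q f (H1 H2 : R) : csub S Q -> locLp mu p f ->
  (\sum_(2 <= k <oo) ((alpha k)%:E * avgp mu p (dil k S) (B Q f)) < H1%:E)%E ->
  (\sum_(2 <= k <oo) ((alpha k)%:E * avgp mu p (dil k Q) (B S f)) < H2%:E)%E ->
  {ae mu, forall x, cset S x -> `|B Q f x| <= `|B S f x| + (2 * H1 + 2 * H2)}.
Proof.
move=> SQ lf h1 h2; have [opB [com _]] := BO.
have lQ := (opB Q).1 _ lf; have lS := (opB S).1 _ lf.
apply: filterS3 (Aop_le lQ h1) (Aop_le lS h2) (com S Q f lf) => x k1 k2 k3 Sx.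
have {k1} := k1 (csub_cset (csub_dil_self 1 S) Sx).
have {k2} := k2 (csub_cset (csub_dil_self 1 Q) (csub_cset SQ Sx)).
rewrite /Aop k3 => k2 k1.
have -> : B Q f x = B S f x + ((B Q f x - B Q (B S f) x) - (B S f x - B Q (B S f) x)) by ring.
apply: le_trans (ler_normD _ _) _; rewrite lerD2l.
by apply: le_trans (ler_normB _ _) _; exact: lerD.
Qed.

Variables (D : R) (a : cube R n -> R) (f : n.-tuple R -> R) (Q0 : cube R n) (L : R).
Hypothesis D1 : 1 <= D.
Hypothesis lf : locLp mu p f.
Hypothesis aD : Dinf D a.
Hypothesis af : forall (k : nat) (Q : cube R n),
  (avgp mu p (dil k Q) (B Q f) <= (a (dil k Q))%:E)%E.
Hypothesis lL :
  (\sum_(1 <= k <oo) ((eta_seq alpha k)%:E * (a (dil k Q0))%:E) <= L%:E)%E.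

Let alpha0 : forall k, 0 <= alpha k.
Proof. by have [_ [_ [_ []]]] := BO. Qed.

Let a0 Q : 0 <= a Q. Proof. exact: aD.1. Qed.

Let eta0 k : 0 <= eta_seq alpha k.
Proof. by rewrite /eta_seq; case: ifP => // _; case: ifP => // _; rewrite le_max alpha0. Qed.

Let eta_a0 k : (0 <= (eta_seq alpha k)%:E * (a (dil k Q0))%:E)%E.
Proof. by rewrite mule_ge0// lee_fin. Qed.

Lemma a_csub S Q : csub S Q -> a S <= D * a Q.
Proof. by move=> /csub_cset; exact: aD.2. Qed.

(** The term k = 1, where [eta_seq] equals 1. Through [Dinf] it bounds the average over the double
    of every cube of the recursion. *)
Lemma a_dil1_le : a (dil 1 Q0) <= L.
Proof.
rewrite -lee_fin; apply: le_trans lL.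
have := @nneseries_term (fun k => (eta_seq alpha k)%:E * (a (dil k Q0))%:E)%E 1 1 eta_a0 (leqnn _).
by rewrite /= /eta_seq eqxx mul1e.
Qed.

Let alpha_a0 k : (0 <= (alpha k)%:E * (a (dil (k + 3) Q0))%:E)%E.
Proof. by rewrite mule_ge0// lee_fin. Qed.

(** For k >= 2 the index k + 3 is at least 5, where [eta_seq] is a maximum that includes alpha_k. *)
Lemma sum_alpha_a_le :
  (\sum_(2 <= k <oo) ((alpha k)%:E * (a (dil (k + 3) Q0))%:E) <= L%:E)%E.
Proof.
apply: le_trans lL.
apply: (@le_trans _ _ (\sum_(2 <= k <oo)
    ((eta_seq alpha (k + 3))%:E * (a (dil (k + 3) Q0))%:E))%E); last first.
  exact: (@nneseries_shift (fun k => (eta_seq alpha k)%:E * (a (dil k Q0))%:E)%E).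
apply: lee_nneseries_from => // k k2; apply: lee_wpmul2r; first by rewrite lee_fin.
rewrite lee_fin /eta_seq addn3 /= (_ : (k.+3 <= 4)%N = false); last first.
  by apply/negbTE; rewrite -ltnNge.
by rewrite le_max subSS subSS subSS subn0 lexx orbT.
Qed.

Let K0 : 0 <= 2 ^+ n :> R. Proof. exact: exprn_ge0. Qed.

Let avgp_pos k Q g : (0 <= (alpha k)%:E * avgp mu p (dil k Q) g)%E.
Proof. by rewrite mule_ge0 ?avgp_ge0// lee_fin. Qed.

(** 2^k Q lies in 2^(k+m+1) S, at the cost of 2^n; there the hypothesis on B_S f applies, and this
    dilate lies in 2^(k+2) Q, hence in 2^(k+3) Q0. *)
Lemma sum_avg_coarse S Q m : csub S Q -> csub Q Q0 -> side Q = 2 ^+ m * side S ->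
  (\sum_(2 <= k <oo) ((alpha k)%:E * avgp mu p (dil k Q) (B S f)) <=
   (2 ^+ n * (D * L))%:E)%E.
Proof.
move=> SQ QQ0 e; have [mBf _] := (BO.1 S).1 _ lf.
have D0 : 0 <= D by exact: le_trans D1.
apply: (@le_trans _ _ (\sum_(2 <= k <oo)
    ((2 ^+ n * D)%:E * ((alpha k)%:E * (a (dil (k + 3) Q0))%:E)))%E); last first.
  rewrite nneseriesZl; last by move=> i _; exact: alpha_a0.
  rewrite [X in (_ <= X%:E)%E]mulrA [leRHS]EFinM.
  apply: lee_wpmul2l; last exact: sum_alpha_a_le.
  by rewrite lee_fin mulr_ge0.
apply: lee_nneseries_from => // [i|k _].
  by rewrite mule_ge0// lee_fin mulr_ge0.
rewrite muleCA; apply: lee_wpmul2l; first by rewrite lee_fin.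
apply: (le_trans (avgp_csub mu p1 mBf (csub_dil_descendant k SQ e) _)).
  by rewrite /= e exprS exprD !mulrA.
rewrite EFinM -muleA; apply: lee_wpmul2l; first by rewrite lee_fin.
apply: (le_trans (af _ _)); rewrite -EFinM lee_fin; apply: a_csub.
apply: csub_trans (csub_dil_descendant_dil k SQ e).
by apply: csub_trans (csub_dil _ QQ0) _; apply: csub_dil_le; rewrite addn3.
Qed.

(** For k <= m, 2^k S lies in the double of the ancestor k generations up, where the average is at
    most t. For k > m it lies in 2^(k-m+1) Q, a dilate of Q, where the hypothesis on B_Q f
    applies. *)
Lemma sum_avg_fine S Q m (t : R) : csub S Q -> csub Q Q0 -> side Q = 2 ^+ m * side S ->
  0 <= t ->
  (forall k, (2 <= k <= m)%N -> exists S', [/\ csub S S', side S' = 2 ^+ k * side S &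
    (avgp mu p (dil 1 S') (B Q f) <= t%:E)%E]) ->
  (\sum_(2 <= k <oo) ((alpha k)%:E * avgp mu p (dil k S) (B Q f)) <=
   (2 ^+ n)%:E * (t%:E * \sum_(2 <= k <oo) (alpha k)%:E + (D * L)%:E))%E.
Proof.
move=> SQ QQ0 e t0 anc; have [mBf _] := (BO.1 Q).1 _ lf.
have D0 : 0 <= D by exact: le_trans D1.
apply: (@le_trans _ _ (\sum_(2 <= k <oo)
    ((2 ^+ n)%:E * (t%:E * (alpha k)%:E +
      D%:E * ((alpha k)%:E * (a (dil (k + 3) Q0))%:E))))%E); last first.
  rewrite nneseriesZl; last first.
    by move=> i _; apply: adde_ge0; rewrite !mule_ge0// !lee_fin.
  apply: lee_wpmul2l; first by rewrite lee_fin.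
  rewrite nneseriesD => [|i _ _|i _ _]; [|by rewrite !mule_ge0// !lee_fin..].
  rewrite !nneseriesZl => [|i _|i _]; [|by rewrite ?mule_ge0// lee_fin..].
  apply: leeD => //.
  by rewrite EFinM; apply: lee_wpmul2l; [rewrite lee_fin | exact: sum_alpha_a_le].
apply: lee_nneseries_from => // [i|k k2].
  apply: mule_ge0; first by rewrite lee_fin.
  by apply: adde_ge0; rewrite !mule_ge0// !lee_fin.
suff h : (avgp mu p (dil k S) (B Q f) <= (2 ^+ n * (t + D * a (dil (k + 3) Q0)))%:E)%E.
  apply: (@le_trans _ _ ((alpha k)%:E * (2 ^+ n * (t + D * a (dil (k + 3) Q0)))%:E)%E).
    by apply: lee_wpmul2l => //; rewrite lee_fin.
  by rewrite -!(EFinM, EFinD) lee_fin le_eqVlt; apply/orP; left; apply/eqP; ring.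
have [km|mk] := leqP k m.
  have [|S' [SS' e' S't]] := anc k; first by rewrite k2.
  apply: (le_trans (avgp_csub mu p1 mBf (csub_dil_ancestor SS' e') _)).
    by rewrite /= expr1 e'.
  rewrite EFinM; apply: lee_wpmul2l; first by rewrite lee_fin.
  by apply: (le_trans S't); rewrite lee_fin lerDl mulr_ge0.
have ek : k = ((k - m) + m)%N by rewrite subnK// ltnW.
apply: (@le_trans _ _ ((2 ^+ n)%:E * avgp mu p (dil (k - m).+1 Q) (B Q f))%E).
  rewrite {1}ek; apply: (avgp_csub mu) => //; first exact: csub_dil_overshoot.
  by rewrite /= e exprS exprD !mulrA.
rewrite EFinM; apply: lee_wpmul2l; first by rewrite lee_fin.
apply: (le_trans (af _ _)); rewrite lee_fin.
apply: (@le_trans _ _ (D * a (dil (k + 3) Q0))); last by rewrite lerDr.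
apply: a_csub; apply: csub_trans (csub_dil _ QQ0); apply: csub_dil_le.
by rewrite addn3 ltnS; apply: leq_trans (leq_subr _ _) _; rewrite -addn2 leq_addr.
Qed.

End operators.

(** * Exponential integrability *)

Section self_improvement.
Variables (R : realType) (n : nat) (mu : {measure set (n.-tuple R) -> \bar R}).
Variables (p : R) (B : cube R n -> (n.-tuple R -> R) -> (n.-tuple R -> R)).
Variables (alpha beta : nat -> R).
Hypothesis lmu : is_lebesgue mu.
Hypothesis p1 : 1 <= p.
Hypothesis BO : classO mu p B alpha beta.
Variables (D : R) (a : cube R n -> R) (f : n.-tuple R -> R) (Q0 : cube R n) (L A : R).
Hypothesis D1 : 1 <= D.
Hypothesis lf : locLp mu p f.
Hypothesis aD : Dinf D a.
Hypothesis af : forall (k : nat) (Q : cube R n),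
  (avgp mu p (dil k Q) (B Q f) <= (a (dil k Q))%:E)%E.
Hypothesis L0 : 0 < L.
Hypothesis lL :
  (\sum_(1 <= k <oo) ((eta_seq alpha k)%:E * (a (dil k Q0))%:E) <= L%:E)%E.
Hypothesis A0 : 0 <= A.
Hypothesis lA : (\sum_(2 <= k <oo) (alpha k)%:E <= A%:E)%E.

Let p0 : 0 < p. Proof. exact: lt_le_trans p1. Qed.
Let D0 : 0 < D. Proof. exact: lt_le_trans D1. Qed.
Let e0 : 0 < 2 ^+ n :> R. Proof. exact: exprn_gt0. Qed.

(** The averages over 2Q are at most D L. The covering costs (2^n)^3, the volume of 2Q one more 2^n,
    and the half a factor 2; this product is at least 1, so its p-th power dominates it. *)
Let t := D * L * (2 * (2 ^+ n) ^+ 4).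

Let t0 : 0 < t. Proof. by rewrite !mulr_gt0// !exprn_gt0. Qed.

(** Times L, the first summand is the bound 2 (2^n t) off the stopped cells and the second is the
    jump 2 H1 + 2 H2 of [B_diff_le] on them; their sum serves for both. *)
Definition jump_const : R :=
  2 * 2 ^+ n * (D * (2 * (2 ^+ n) ^+ 4)) +
  (2 * (2 ^+ n * (D * (2 * (2 ^+ n) ^+ 4) * A + D) + 1) + 2 * (2 ^+ n * D + 1)).

Lemma jump_const_gt0 : 0 < jump_const.
Proof.
have e4 : 0 < (2 ^+ n) ^+ 4 :> R by rewrite exprn_gt0.
have [[? ?] ?] := (ltW e0, ltW e4, ltW D0).
rewrite /jump_const; apply: ltr_pwDl; first by rewrite !mulr_gt0.
by rewrite !(addr_ge0, mulr_ge0).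
Qed.

Local Notation h := (L * jump_const).

Section one_cube.
Variable Q : cube R n.
Hypothesis QQ0 : csub Q Q0.
Local Notation F := (B Q f).

Definition bad_cell m k : Prop := (t%:E < avgp mu p (dil 1 (cell Q m k)) F)%E.

Local Notation Om := (\bigcup_(c in stopped Q bad_cell) cset (cell Q c.1 c.2)).

Let mF : measurable_fun setT F. Proof. by have [] := (BO.1 Q).1 _ lf. Qed.

Let g x := ((`|F x| `^ p)%:E : \bar R).

Let mg : measurable_fun setT g. Proof. exact: measurable_fun_powRn. Qed.

Let g0 x : (0 <= g x)%E. Proof. by rewrite lee_fin powR_ge0. Qed.

Lemma measurable_stopped : measurable Om.
Proof. by apply: countable_bigcup_measurable => c _; exact: measurable_cset. Qed.

Lemma stopped_sub : Om `<=` cset Q.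
Proof. by move=> x [c /csub_stopped /csub_cset]; exact. Qed.

Lemma measure_stopped : (mu Om <= (vol Q / 2)%:E)%E.
Proof.
have V0 := vol_gt0 Q.
have tp0 : 0 < t `^ p by rewrite powR_gt0.
have DL0 : 0 < D * L by rewrite mulr_gt0.
have e4 : 1 <= 2 * (2 ^+ n) ^+ 4 :> R.
  by rewrite -exprM -exprS exp2_ge1.
have e40 : 0 < 2 * (2 ^+ n) ^+ 4 :> R by exact: lt_le_trans e4.
apply: (le_trans (@weak_type _ _ _ lmu _ (stopped Q bad_cell) (fun c => cell Q c.1 c.2)
   (cset (dil 1 Q)) g (t `^ p) tp0 _ mg g0 _ _)).
- exact: measurable_cset.
- by move=> c /csub_stopped /(csub_dil 1); exact: csub_cset.
- move=> c [x [_ _ b _]].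
  have {b} : ~ (avgp mu p (dil 1 (cell Q c.1 c.2)) F <= t%:E)%E.
    by apply/negP; rewrite -ltNge; exact: b.
  move=> /avgp_leP - /(_ p0 (ltW t0)) /negP; rewrite -ltNge => /ltW.
  apply: le_trans; rewrite lee_fin ler_wpM2l ?powR_ge0// vol_dil expr1.
  by rewrite ler_peMl ?exp2_ge1// ltW// vol_gt0.
- have : (\int[mu]_(x in cset (dil 1 Q)) g x <= ((D * L) `^ p * vol (dil 1 Q))%:E)%E.
    apply/avgp_leP => //; first exact: ltW.
    apply: (le_trans (af _ _)); rewrite lee_fin.
    apply: (le_trans (a_csub aD (csub_dil 1 QQ0))).
    by rewrite ler_pM2l//; exact: (a_dil1_le BO aD lL).
  have c0 : (0 <= ((2 ^+ n) ^+ 3 / t `^ p)%:E)%E.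
    by rewrite lee_fin divr_ge0 ?exprn_ge0// ltW.
  move=> /(lee_wpmul2l c0) /le_trans; apply.
  rewrite -EFinM lee_fin vol_dil expr1 mulrAC ler_pdivrMr//.
  have : (D * L) `^ p * (2 * (2 ^+ n) ^+ 4) <= t `^ p.
    have -> : t `^ p = (D * L) `^ p * (2 * (2 ^+ n) ^+ 4) `^ p.
      by rewrite /t powRM ?(ltW DL0) ?(ltW e40).
    apply: ler_wpM2l; first exact: powR_ge0.
    by rewrite -{1}[2 * _]powRr1 ?(ltW e40)// ler_powR.
  move=> /(ler_wpM2l (ltW V0)).
  have -> : (2 ^+ n) ^+ 3 * ((D * L) `^ p * (2 ^+ n * vol Q)) =
    vol Q * ((D * L) `^ p * (2 * (2 ^+ n) ^+ 4)) / 2 by field.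
  by move=> le; rewrite [leRHS]mulrAC ler_pM2r ?invr_gt0.
Qed.

Lemma off_stopped : {ae mu, forall x, (cset Q `\` Om) x -> `|F x| <= h}.
Proof.
(* Non-badness bounds the average over the doubled cell by t; passing to the cell itself costs 2^n.
   The factor 2 opens the strict gap that differentiation needs. *)
set c := 2 ^+ n * t; set c' := 2 * c.
have c0 : 0 < c by rewrite mulr_gt0.
have cc' : c < c' by rewrite /c' mulr_natl mulr2n ltrDl.
have c'0 : 0 < c' by exact: lt_trans cc'.
have ch : c' <= h.
  rewrite /c' /c /t /jump_const mulrDr.
  have -> : L * (2 * 2 ^+ n * (D * (2 * (2 ^+ n) ^+ 4))) =
     2 * (2 ^+ n * (D * L * (2 * (2 ^+ n) ^+ 4))) by ring.
  have ? := ltW L0; have ? := ltW D0; have ? := ltW e0.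
  by rewrite lerDl !(mulr_ge0, addr_ge0)// ?exprn_ge0.
pose E := (cset Q `\` Om) `&` [set x | c' < `|F x|].
have mE : measurable E.
  apply: measurableI; first by apply: measurableD; [exact: measurable_cset | exact: measurable_stopped].
  rewrite (_ : [set x | _] = (fun x => `|F x|) @^-1` `]c', +oo[).
    rewrite -[X in measurable X]setTI.
    by apply: (@measurableT_comp _ _ _ _ _ _ (@Num.norm _ R)) => //; exact: measurable_itv.
  by apply/seteqP; split => x /=; rewrite in_itv /= andbT.
have : mu E = 0.
  apply: (@null_of_small_averages _ _ _ lmu Q g (c `^ p) (c' `^ p)) => //.
  - exact: powR_ge0.
  - by apply: gt0_ltr_powR; rewrite ?nnegrE ?(ltW c0) ?(ltW c'0).
  - by move=> x [[]].
  - move=> x [_ /= /ltW ?]; rewrite lee_fin.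
    by apply: ge0_ler_powR; rewrite ?nnegrE ?(ltW p0) ?(ltW c'0).
  - move=> x m [[Qx nO] _].
    apply/avgp_leP => //; first exact: ltW.
    apply: (le_trans (avgp_csub mu p1 mF (csub_dil_self 1 _) _)); first by rewrite /= expr1.
    rewrite EFinM; apply: lee_wpmul2l; first by rewrite lee_fin ltW.
    by rewrite leNgt; apply/negP; exact: not_stopped nO.
move=> E0; exists E; split => // x /= /not_implyP [Qx /negP]; rewrite -ltNge => hF.
by split => //=; exact: le_lt_trans hF.
Qed.

Lemma on_stopped c : stopped Q bad_cell c ->
  {ae mu, forall x, cset (cell Q c.1 c.2) x ->
    `|F x| <= `|B (cell Q c.1 c.2) f x| + h}.
Proof.
move=> Sc; have SQ := csub_stopped Sc; set S := cell Q c.1 c.2 in SQ *.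
have e : side Q = 2 ^+ c.1 * side S by exact: side_cell_root.
have [x [Qx ix _ nb]] := Sc.
(* The extra L, here and in [h2], makes the inequality strict. *)
have h1 : (\sum_(2 <= k <oo) ((alpha k)%:E * avgp mu p (dil k S) F) <
    (2 ^+ n * (t * A + D * L) + L)%:E)%E.
  apply: (@le_lt_trans _ _ (2 ^+ n * (t * A + D * L))%:E); last first.
    by rewrite lte_fin ltrDl.
  apply: (le_trans (sum_avg_fine p1 BO D1 lf aD af lL SQ QQ0 e (ltW t0) _)).
    (* Since k >= 2, this ancestor belongs to a strictly earlier generation, so it is not bad. *)
    move=> k /andP[k2 km]; exists (cell Q (c.1 - k) (idx Q (c.1 - k) x)).
    have ek : c.1 = (c.1 - k + k)%N by rewrite subnK.
    split.
    - by rewrite /S -ix {1 2}ek; exact: csub_cell_cell.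
    - by rewrite /S [in RHS]ek; exact: side_cell.
    - rewrite leNgt; apply/negP; apply: nb.
      by rewrite ltn_subrL (leq_trans _ km) ?(leq_trans _ k2).
  rewrite [(2 ^+ n * _)%:E]EFinM [(t * A + _)%:E]EFinD [(t * A)%:E]EFinM.
  apply: lee_wpmul2l; first by rewrite lee_fin ltW.
  by apply: leeD => //; apply: lee_wpmul2l => //; rewrite lee_fin ltW.
have h2 : (\sum_(2 <= k <oo) ((alpha k)%:E * avgp mu p (dil k Q) (B S f)) <
    (2 ^+ n * (D * L) + L)%:E)%E.
  apply: (le_lt_trans (sum_avg_coarse p1 BO D1 lf aD af lL SQ QQ0 e)).
  by rewrite lte_fin ltrDl.
have := B_diff_le p1 BO SQ lf h1 h2.
apply: filterS => y hy /hy /le_trans; apply; rewrite lerD2l.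
rewrite /jump_const [L * _]mulrDr.
have -> : 2 * (2 ^+ n * (t * A + D * L) + L) + 2 * (2 ^+ n * (D * L) + L) =
  L * (2 * (2 ^+ n * (D * (2 * (2 ^+ n) ^+ 4) * A + D) + 1) + 2 * (2 ^+ n * D + 1)).
  by rewrite /t; ring.
have ? := ltW L0; have ? := ltW D0; have ? := ltW e0.
by rewrite lerDr !mulr_ge0// ?exprn_ge0.
Qed.

End one_cube.

Variables (w : n.-tuple R -> R) (gam : R).
Hypothesis mw : measurable_fun setT w.
Hypothesis w0 : forall x, 0 <= w x.
Hypothesis wfin : forall Q, (wmeas mu w Q < +oo)%E.
Hypothesis gam01 : 0 <= gam < 1.
Hypothesis wgam : forall (Q : cube R n) E, measurable E -> E `<=` cset Q ->
  (mu E <= (vol Q / 2)%:E)%E -> (\int[mu]_(x in E) (w x)%:E <= gam%:E * wmeas mu w Q)%E.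

Section truncated.
Variables (N l : R).
Hypothesis N0 : 0 <= N.
Hypothesis l0 : 0 < l.

(** Truncating |y| before exponentiating keeps the integrals finite and commutes with additive jumps
    up to an inequality, as [texp_jump] requires. *)
Definition texp (y : R) : R := expR (Num.min `|y| N / l) - 1.

Lemma texp_ge0 y : 0 <= texp y.
Proof.
rewrite subr_ge0 -expR0 ler_expR divr_ge0 ?(ltW l0)//.
by rewrite le_min normr_ge0.
Qed.

Lemma texp_jump y z (k : R) : 0 <= k -> `|y| <= `|z| + k ->
  texp y <= expR (k / l) * texp z + (expR (k / l) - 1).
Proof.
move=> k0 yz; rewrite /texp mulrBr mulr1 -expRD addrA subrK lerD2r ler_expR.
rewrite -mulrDl ler_pM2r ?invr_gt0// addrC.
have [zN|Nz] := leP `|z| N; first by apply: le_trans yz; rewrite ge_min lexx.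
by apply: (@le_trans _ _ N); rewrite ?ge_min ?lexx ?orbT// lerDl.
Qed.

Lemma measurable_texp g : measurable_fun setT g ->
  measurable_fun setT (fun x : n.-tuple R => texp (g x)).
Proof.
move=> mg; apply: measurable_funB => //.
have me := @measurable_expR R; apply: (measurableT_comp me).
apply: measurable_funM => //.
by apply: measurable_minr => //; exact: measurableT_comp.
Qed.

Let mEF (u : n.-tuple R -> R) (E : set (n.-tuple R)) : measurable_fun setT u ->
  measurable_fun E (fun x : n.-tuple R => (u x)%:E).
Proof.
by move=> mu_; apply: (@measurable_funS _ _ _ _ setT) => //; apply/measurable_EFinP.
Qed.

Let mBf Q : measurable_fun setT (B Q f). Proof. by have [] := (BO.1 Q).1 _ lf. Qed.

Local Notation q := (expR (h / l)).

Let h0 : 0 < h. Proof. by rewrite mulr_gt0// jump_const_gt0. Qed.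

Let q1 : 1 <= q.
Proof. by rewrite -expR0 ler_expR divr_ge0// ltW. Qed.

(** Off the stopped cells the integrand is at most (q - 1) w; on each of them the jump gives q psi +
    q - 1 times its weight. The terms q - 1 add up to w(Q), and psi is multiplied by q and by the
    fraction gam. The assumption covers all subcubes of [Q0] because each stopped cell S brings its
    own function B_S f. *)
Lemma texp_step (psi : R) : 0 <= psi ->
  (forall S, csub S Q0 ->
    (\int[mu]_(x in cset S) ((texp (B S f x) * w x)%:E) <= psi%:E * wmeas mu w S)%E) ->
  forall Q, csub Q Q0 ->
    (\int[mu]_(x in cset Q) ((texp (B Q f x) * w x)%:E) <=
     (q - 1 + q * gam * psi)%:E * wmeas mu w Q)%E.
Proof.
move=> psi0 IH Q QQ0.
have mO := measurable_stopped Q; have OQ := @stopped_sub Q; have muO := measure_stopped QQ0.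
set Om := \bigcup_(c in stopped Q (bad_cell Q)) cset (cell Q c.1 c.2) in mO OQ muO.
have mQ := measurable_cset Q.
have mu1 g : measurable_fun setT g -> measurable_fun setT (fun x => texp (g x) * w x).
  by move=> mg; apply: measurable_funM => //; exact: measurable_texp.
pose u x := ((texp (B Q f x) * w x)%:E : \bar R).
have u0 x : (0 <= u x)%E by rewrite lee_fin mulr_ge0// texp_ge0.
have q10 : 0 <= q - 1 by rewrite subr_ge0.
have q0 : 0 <= q by exact: expR_ge0.
have cw (k : R) (E : set (n.-tuple R)) : 0 <= k -> measurable E ->
    (\int[mu]_(x in E) ((k * w x)%:E) = k%:E * \int[mu]_(x in E) (w x)%:E)%E.
  move=> k0 mE; under eq_integral do rewrite EFinM.
  by rewrite ge0_integralZl_EFin// => [x _|]; [rewrite lee_fin | exact: mEF].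
have onO : (\int[mu]_(x in Om) u x <= (q * psi + (q - 1))%:E * \int[mu]_(x in Om) (w x)%:E)%E.
  have c0 : 0 <= q * psi + (q - 1) by rewrite addr_ge0// mulr_ge0.
  rewrite -cw//; apply: integral_le_pieces.
  - by move=> c _; exact: measurable_cset.
  - exact: trivIset_stopped.
  - by apply: mEF; exact: mu1.
  - by apply: mEF; exact: measurable_funM.
  - exact: u0.
  - by move=> x; rewrite lee_fin mulr_ge0.
  - move=> c Sc; set S := cell Q c.1 c.2; have mS := measurable_cset S.
    have SQ0 : csub S Q0 by apply: csub_trans QQ0 _; exact: csub_stopped Sc.
    apply: (@le_trans _ _ (\int[mu]_(x in cset S)
       (q%:E * (texp (B S f x) * w x)%:E + ((q - 1) * w x)%:E))%E).
      apply: ae_ge0_le_integral => //.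
      + by apply: mEF; exact: mu1.
      + move=> x _; apply: adde_ge0; first by rewrite mule_ge0// ?lee_fin ?mulr_ge0 ?texp_ge0.
        by rewrite lee_fin mulr_ge0.
      + apply: emeasurable_funD; last by apply: mEF; exact: measurable_funM.
        by apply: measurable_funeM; apply: mEF; exact: mu1.
      + have := on_stopped QQ0 Sc; apply: filterS => x hx /hx hS.
        rewrite -EFinM -EFinD lee_fin mulrA -mulrDl; apply: ler_wpM2r => //.
        by apply: texp_jump => //; exact: ltW.
    rewrite ge0_integralD//; last first.
    + by apply: mEF; exact: measurable_funM.
    + by move=> x _; rewrite lee_fin mulr_ge0.
    + by apply: measurable_funeM; apply: mEF; exact: mu1.
    + by move=> x _; rewrite mule_ge0// ?lee_fin ?mulr_ge0 ?texp_ge0.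
    rewrite ge0_integralZl_EFin//; last first.
    + by apply: mEF; exact: mu1.
    + by move=> x _; rewrite lee_fin mulr_ge0 ?texp_ge0.
    rewrite !cw// [(q * psi + (q - 1))%:E]EFinD ge0_muleDl ?lee_fin// ?mulr_ge0//.
    by apply: leeD => //; rewrite [(q * psi)%:E]EFinM -muleA; apply: lee_wpmul2l => //; exact: IH.
have offO : (\int[mu]_(x in cset Q `\` Om) u x <= (q - 1)%:E * \int[mu]_(x in cset Q `\` Om) (w x)%:E)%E.
  rewrite -cw//; last exact: measurableD.
  apply: ae_ge0_le_integral => //.
  - exact: measurableD.
  - by apply: mEF; exact: mu1.
  - by move=> x _; rewrite lee_fin mulr_ge0.
  - by apply: mEF; exact: measurable_funM.
  - have := off_stopped Q; apply: filterS => x hx /hx hS.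
    rewrite lee_fin; apply: ler_wpM2r => //.
    (* Comparison with the value 0, where the truncated exponential vanishes. *)
    have := @texp_jump (B Q f x) 0 h (ltW h0).
    rewrite normr0 add0r => /(_ hS); congr (_ <= _).
    by rewrite /texp normr0 min_l// mul0r expR0 subrr mulr0 add0r.
have split_ (v : n.-tuple R -> \bar R) : measurable_fun setT v -> (forall x, 0 <= v x)%E ->
    (\int[mu]_(x in cset Q) v x = \int[mu]_(x in cset Q `\` Om) v x + \int[mu]_(x in Om) v x)%E.
  move=> mv v0; rewrite -ge0_integral_setU//.
  - by rewrite setUC setDUK.
  - exact: measurableD.
  - exact: measurable_funTS.
  - by apply/disj_setPS => x [[]].
rewrite (split_ u)//; last by apply: mEF; exact: mu1.
have wsplit : (\int[mu]_(x in cset Q) (w x)%:E =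
    \int[mu]_(x in cset Q `\` Om) (w x)%:E + \int[mu]_(x in Om) (w x)%:E)%E.
  by apply: (split_ (EFin \o w)); [exact: mEF | move=> x; rewrite lee_fin].
apply: (le_trans (leeD offO onO)).
have wO := wgam mO OQ muO.
have iO0 (E : set (n.-tuple R)) : (0 <= \int[mu]_(x in E) (w x)%:E)%E.
  by apply: integral_ge0 => x _; rewrite lee_fin.
rewrite (_ : (q * psi + (q - 1))%:E * _ = (q - 1)%:E * \int[mu]_(x in Om) (w x)%:E +
   (q * psi)%:E * \int[mu]_(x in Om) (w x)%:E)%E; last first.
  by rewrite [(q * psi + (q - 1))%:E]EFinD ge0_muleDl ?lee_fin ?mulr_ge0// addeC.
rewrite addeA -ge0_muleDr//.
rewrite -wsplit.
have /andP[? _] := gam01.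
rewrite [(q - 1 + _)%:E]EFinD ge0_muleDl ?lee_fin ?mulr_ge0//.
apply: leeD => //.
have -> : ((q * gam * psi)%:E = (q * psi)%:E * gam%:E)%E by rewrite -EFinM mulrAC.
rewrite -muleA; apply: lee_wpmul2l => //.
by rewrite lee_fin mulr_ge0.
Qed.

End truncated.

Hypothesis wpos : forall Q, (0 < wmeas mu w Q)%E.

Definition exp_scale : R := h / ln (2 / (1 + gam)).

Let ratio_gt1 : 1 < 2 / (1 + gam).
Proof. by have /andP[? ?] := gam01; rewrite ltr_pdivlMr; lra. Qed.

Lemma exp_scale_gt0 : 0 < exp_scale.
Proof. by rewrite divr_gt0 ?ln_gt0// mulr_gt0// jump_const_gt0. Qed.

(* [expR (h / exp_scale) = 2 / (1 + gam)] is the value for which 1 is the fixed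
   point of the affine contraction of [texp_step]. *)
Lemma texp_integral_le (N : R) Q : 0 <= N -> csub Q Q0 ->
  (\int[mu]_(x in cset Q) ((texp N exp_scale (B Q f x) * w x)%:E) <= wmeas mu w Q)%E.
Proof.
move=> N0 QQ0; have l0 := exp_scale_gt0; have /andP[g0 g1] := gam01.
have h0 : 0 < h by rewrite mulr_gt0// jump_const_gt0.
have lr0 : 0 < ln (2 / (1 + gam)) by rewrite ln_gt0.
have qE : expR (h / exp_scale) = 2 / (1 + gam).
  rewrite /exp_scale invfM invrK mulrA divff ?gt_eqF// mul1r lnK// posrE.
  by rewrite divr_gt0//; lra.
set r := 2 / (1 + gam) * gam.
have r0 : 0 <= r by rewrite mulr_ge0// divr_ge0//; lra.
have r1 : r < 1 by rewrite /r mulrAC ltr_pdivrMr; lra.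
have rE : 2 / (1 + gam) - 1 = 1 - r.
  by rewrite /r; field; rewrite gt_eqF//; lra.
pose K := expR (N / exp_scale).
have K0 : 0 <= K by exact: expR_ge0.
have psi0 j : 0 <= 1 + r ^+ j * K by rewrite addr_ge0// mulr_ge0// exprn_ge0.
(* The bound [K] on the truncated exponential starts the induction; each step multiplies the excess
   over the fixed point 1 by r < 1, so N disappears in the limit. *)
have step j : forall S, csub S Q0 ->
    (\int[mu]_(x in cset S) ((texp N exp_scale (B S f x) * w x)%:E) <=
     (1 + r ^+ j * K)%:E * wmeas mu w S)%E.
  elim: j => [|j IH] S SQ0.
    rewrite -ge0_integralZl_EFin ?psi0//; first last.
    - by apply: (@measurable_funS _ _ _ _ setT) => //; apply/measurable_EFinP.
    - by move=> x _; rewrite lee_fin.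
    - exact: measurable_cset.
    have mBS : measurable_fun setT (B S f) by have [] := (BO.1 S).1 _ lf.
    apply: ge0_le_integral.
    - exact: measurable_cset.
    - by move=> x _; rewrite lee_fin mulr_ge0// texp_ge0.
    - apply: (@measurable_funS _ _ _ _ setT) => //; apply/measurable_EFinP.
      by apply: measurable_funM => //; exact: measurable_texp.
    - apply: measurable_funeM.
      by apply: (@measurable_funS _ _ _ _ setT) => //; apply/measurable_EFinP.
    - move=> x _; rewrite -EFinM lee_fin; apply: ler_wpM2r => //.
      rewrite expr0 mul1r /texp (@le_trans _ _ K)//; last by rewrite lerDr.
      rewrite lerBlDr (@le_trans _ _ K)// ?lerDl// ler_expR.
      by rewrite ler_pM2r ?invr_gt0// ge_min lexx orbT.
  have := texp_step N0 l0 (psi0 j) IH SQ0; rewrite qE -/r rE.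
  by have -> : 1 - r + r * (1 + r ^+ j * K) = 1 + r ^+ j.+1 * K by rewrite exprS; ring.
have wQ : wmeas mu w Q \is a fin_num by rewrite ge0_fin_numE ?wfin// ltW.
set W := fine (wmeas mu w Q).
have cvgW : ((1 + r ^+ j * K) * W)%:E @[j --> \oo] --> ((1 + 0 * K) * W)%:E.
  apply: cvg_EFin; first exact: nearW.
  apply: cvgM; last exact: cvg_cst.
  apply: cvgD; first exact: cvg_cst.
  by apply: cvgM; [apply: cvg_expr; rewrite ger0_norm | exact: cvg_cst].
have -> : wmeas mu w Q = ((1 + 0 * K) * W)%:E.
  by rewrite mul0r addr0 mul1r fineK.
apply: (cvge_to_ge cvgW); apply: nearW => j.
by rewrite EFinM /W fineK//; exact: step.
Qed.

Lemma exp_integral_le : (\int[mu]_(x in cset Q0)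
  (((expR (`|B Q0 f x| / exp_scale) - 1) * w x)%:E) <= wmeas mu w Q0)%E.
Proof.
have l0 := exp_scale_gt0.
have mB0 : measurable_fun setT (B Q0 f) by have [] := (BO.1 Q0).1 _ lf.
pose u (N : nat) x := ((texp N%:R exp_scale (B Q0 f x) * w x)%:E : \bar R).
have ulim x : limn (u^~ x) = ((expR (`|B Q0 f x| / exp_scale) - 1) * w x)%:E.
  apply/cvg_lim => //; apply: cvg_near_cst.
  exists (Num.truncn `|B Q0 f x|).+1 => // N /= hN.
  rewrite /u /texp min_l//; apply: (@le_trans _ _ (Num.truncn `|B Q0 f x|).+1%:R).
    exact/ltW/truncnS_gt.
  by rewrite ler_nat.
rewrite (_ : (fun x => _) = (fun x => limn (u^~ x))); last by apply/funext => x; rewrite ulim.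
have cvgu : (\int[mu]_(x in cset Q0) u N x)%E @[N --> \oo] -->
    (\int[mu]_(x in cset Q0) (fun x => limn (u^~ x)) x)%E.
  apply: cvg_monotone_convergence.
  - exact: measurable_cset.
  - move=> N; apply: (@measurable_funS _ _ _ _ setT) => //; apply/measurable_EFinP.
    by apply: measurable_funM => //; exact: measurable_texp.
  - by move=> N x _; rewrite lee_fin mulr_ge0// texp_ge0.
  - move=> x _ i j ij; rewrite lee_fin; apply: ler_wpM2r => //.
    rewrite /texp lerD2r ler_expR ler_pM2r ?invr_gt0//.
    by rewrite le_min !ge_min lexx /= ler_nat ij orbT.
apply: (cvge_to_le cvgu); apply: nearW => N.
by apply: texp_integral_le => //; exact: csub_refl.
Qed.

End self_improvement.

(** * Muckenhoupt weights *)

Section weights.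
Variables (R : realType) (n : nat) (mu : {measure set (n.-tuple R) -> \bar R}).
Hypothesis lmu : is_lebesgue mu.
Variable w : n.-tuple R -> R.
Hypothesis ww : weight mu w.

Let mw : measurable_fun setT w. Proof. exact: ww.1. Qed.
Let w0 x : 0 <= w x. Proof. exact: ww.2.1. Qed.
Let wfin Q : (wmeas mu w Q < +oo)%E. Proof. exact: ww.2.2.1. Qed.
Let wae : {ae mu, forall x, 0 < w x}. Proof. exact: ww.2.2.2. Qed.
Let mw' (E : set (n.-tuple R)) : measurable_fun E (fun x => (w x)%:E).
Proof. by apply: (@measurable_funS _ _ _ _ setT) => //; apply/measurable_EFinP. Qed.

Let mQ Q := measurable_cset (R := R) (n := n) Q.

Lemma wmeas_gt0 Q : (0 < wmeas mu w Q)%E.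
Proof.
rewrite lt0e; apply/andP; split; last by apply: integral_ge0 => x _; rewrite lee_fin.
apply/eqP => W0.
have : (\int[mu]_(x in cset Q) `|(w x)%:E| = 0)%E.
  by rewrite -[RHS]W0; apply: eq_integral => x _; rewrite gee0_abs ?lee_fin.
move=> /(ae_eq_integral_abs _ (mQ Q) (@mw' (cset Q))) h.
have : mu (cset Q) = 0.
  apply/negligibleP; first exact: mQ.
  have : {ae mu, forall x, ~ cset Q x}.
    apply: filterS2 h wae => x h wx Qx.
    by have := h Qx => -[] wx0; rewrite wx0 ltxx in wx.
  by move=> [E [mE E0 sE]]; exists E; split => // x Qx; apply: sE => /=; exact.
by move=> Q0; have := vol_gt0 Q; rewrite -lte_fin -lmu Q0 ltxx.
Qed.

Let wfinn Q : wmeas mu w Q \is a fin_num.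
Proof. by rewrite ge0_fin_numE ?wfin// ltW// wmeas_gt0. Qed.

(** The Muckenhoupt conditions bound w(E) from below for large E; the upper bound for small sets
    that the recursion uses follows by complements. *)
Definition thick_bound (c : R) := forall (Q : cube R n) E, measurable E -> E `<=` cset Q ->
  ((vol Q / 2)%:E <= mu E)%E -> (c%:E * wmeas mu w Q <= \int[mu]_(x in E) (w x)%:E)%E.

Lemma thin_of_thick c : 0 <= c -> thick_bound c ->
  forall (Q : cube R n) E, measurable E -> E `<=` cset Q ->
  (mu E <= (vol Q / 2)%:E)%E -> (\int[mu]_(x in E) (w x)%:E <= (1 - c)%:E * wmeas mu w Q)%E.
Proof.
move=> c0 thick Q E mE EQ muE.
have mD : measurable (cset Q `\` E) by apply: measurableD => //; exact: mQ.
have e : cset Q `\` E `|` E = cset Q by rewrite setUC setDUK.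
have dis : [disjoint cset Q `\` E & E] by apply/disj_setPS => x [[]].
have fE := fin_mu_sub lmu mE EQ.
have fD : mu (cset Q `\` E) \is a fin_num.
  by apply: (fin_mu_sub lmu (Q := Q)) => // x [].
have muD : ((vol Q / 2)%:E <= mu (cset Q `\` E))%E.
  have : mu (cset Q) = (mu (cset Q `\` E) + mu E)%E.
    by rewrite -{1}e measureU//; apply/eqP; rewrite -disj_set2E.
  move: muE; rewrite lmu -(fineK fE) -(fineK fD) -EFinD !lee_fin => muE [].
  by move=> e'; lra.
have := thick Q _ mD (@subDsetl _ _ _) muD.
have wE : wmeas mu w Q = (\int[mu]_(x in cset Q `\` E) (w x)%:E + \int[mu]_(x in E) (w x)%:E)%E.
  have w0E x : (cset Q `\` E `|` E) x -> (0 <= (w x)%:E)%E by rewrite lee_fin.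
  by rewrite /wmeas -{1}e ge0_integral_setU.
have i0 F : (0 <= \int[mu]_(x in F) (w x)%:E)%E by apply: integral_ge0 => x _; rewrite lee_fin.
have := wfinn Q; rewrite wE fin_numD => /andP[f1 f2].
rewrite -(fineK f1) -(fineK f2) -EFinD -!EFinM !lee_fin; lra.
Qed.

(** Integrating the pointwise lower bound for w over E, which has at least half the volume, gives
    w(Q) / (2 K'). The maximum with 1 makes the constant positive and c at most 1. *)
Lemma Ap1_thick : Ap mu 1 w -> exists c, 0 < c <= 1 /\ thick_bound c.
Proof.
rewrite /Ap eqxx => -[K hK]; pose K' := Num.max K 1.
have K1 : 1 <= K' by rewrite le_max lexx orbT.
have K0 : 0 < K' by exact: lt_le_trans K1.
exists (2 * K')^-1; split.
  by rewrite invr_gt0 mulr_gt0//= invf_le1 ?mulr_gt0//; lra.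
move=> Q E mE EQ muE.
have V0 := vol_gt0 Q.
have fE := fin_mu_sub lmu mE EQ.
have i0 : (0 <= \int[mu]_(x in E) (w x)%:E)%E by apply: integral_ge0 => x _; rewrite lee_fin.
have : (\int[mu]_(x in E) (cst (((vol Q)^-1)%:E * wmeas mu w Q) x) <=
        \int[mu]_(x in E) (K'%:E * (w x)%:E))%E.
  apply: ae_ge0_le_integral => //.
  - by move=> x _; rewrite mule_ge0// ?lee_fin ?invr_ge0 ltW// wmeas_gt0.
  - by move=> x _; rewrite mule_ge0// lee_fin// ltW.
  - by apply: measurable_funeM; exact: mw'.
  - apply: filterS (hK Q) => x h /EQ /h /le_trans; apply.
    by rewrite -EFinM lee_fin ler_wpM2r// le_max lexx.
have wE0 x : E x -> (0 <= (w x)%:E)%E by rewrite lee_fin.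
rewrite integral_cst// ge0_integralZl_EFin ?(ltW K0)//.
have [iy|fi] := eqVneq (\int[mu]_(x in E) (w x)%:E)%E +oo%E.
  by rewrite iy leey.
have {}fi : (\int[mu]_(x in E) (w x)%:E)%E \is a fin_num by rewrite ge0_fin_numE// ltey.
move: muE; rewrite -(fineK fi) -(fineK fE) -(fineK (wfinn Q)) -!EFinM !lee_fin => muE h.
have W0 : 0 < fine (wmeas mu w Q) by rewrite fine_gt0// wmeas_gt0 wfin.
rewrite invfM mulrC mulrA ler_pdivrMr// [leRHS]mulrC.
apply: le_trans h; rewrite -mulrA [leRHS]mulrCA; apply: ler_wpM2l; first exact: ltW.
by rewrite [leRHS]mulrC ler_pdivlMr// mulrC.
Qed.

(* Chebyshev-style replacement for Hoelder: 1 <= u + u^{-s} for every u > 0,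
   applied to u = lam * w with lam adapted to the average of w. *)
Lemma one_le_add_powRN (u s : R) : 0 < u -> 0 <= s -> 1 <= u + (u `^ s)^-1.
Proof.
move=> u0 s0; have [u1|u1] := leP 1 u.
  by rewrite (le_trans u1)// lerDl invr_ge0 powR_ge0.
have us : u `^ s <= 1.
  by rewrite -[leRHS]/((fun=> 1) s) -powR1; apply: ge0_ler_powR; rewrite ?nnegrE// ltW.
apply: (@le_trans _ _ (u `^ s)^-1); last by rewrite lerDr ltW.
by rewrite invf_ge1// powR_gt0.
Qed.

Lemma Ap_thick p : 1 < p -> Ap mu p w -> exists c, 0 < c <= 1 /\ thick_bound c.
Proof.
move=> p1; rewrite /Ap gt_eqF// => -[K hK]; pose K' := Num.max K 1.
have K1 : 1 <= K' by rewrite le_max lexx orbT.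
have K0 : 0 < K' by exact: lt_le_trans K1.
set s := (p - 1)^-1 in hK *.
have pm1 : 0 < p - 1 by rewrite subr_gt0.
have s0 : 0 < s by rewrite invr_gt0.
have q0 : 1 <= 4 `^ (p - 1) :> R by rewrite -[leLHS](powRr0 4) ler_powR// ?ler1n// ltW.
pose M := K' * 4 `^ (p - 1).
have M1 : 1 <= M by rewrite -[1]mulr1 ler_pM.
have M0 : 0 < M by exact: lt_le_trans M1.
exists (4 * M)^-1; split.
  by rewrite invr_gt0 mulr_gt0//= invf_le1 ?mulr_gt0//; lra.
move=> Q E mE EQ muE.
have V0 := vol_gt0 Q.
have fE := fin_mu_sub lmu mE EQ.
have W0 : 0 < fine (wmeas mu w Q) by rewrite fine_gt0// wmeas_gt0 wfin.
have i0 : (0 <= \int[mu]_(x in E) (w x)%:E)%E by apply: integral_ge0 => x _; rewrite lee_fin.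
have [iy|fi] := eqVneq (\int[mu]_(x in E) (w x)%:E)%E +oo%E.
  by rewrite iy leey.
have {}fi : (\int[mu]_(x in E) (w x)%:E)%E \is a fin_num by rewrite ge0_fin_numE// ltey.
have msg (F : set (n.-tuple R)) : measurable_fun F (fun x => (w x `^ (- s))%:E).
  apply: (@measurable_funS _ _ _ _ setT) => //; apply/measurable_EFinP.
  by apply: (@measurableT_comp _ _ _ _ _ _ (fun x => x `^ (- s))) => //; exact: measurable_powR.
set S := (\int[mu]_(x in cset Q) (w x `^ (- s))%:E)%E.
have S0 : (0 <= S)%E by apply: integral_ge0 => x _; rewrite lee_fin powR_ge0.
have := hK Q; rewrite -/S -(fineK (wfinn Q)) -EFinM.
set W := fine (wmeas mu w Q) in W0 *.
have A0 : 0 < (vol Q)^-1 * W by rewrite mulr_gt0// invr_gt0.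
set A := _^-1 * W in A0 *.
(* Since w(Q) > 0, an infinite dual integral would make the A_p product infinite. *)
have [Sy|fS] := eqVneq S +oo%E.
  rewrite Sy gt0_muley ?lte_fin ?invr_gt0// poweRyr ?gt_eqF// gt0_muley ?lte_fin//.
have {}fS : S \is a fin_num by rewrite ge0_fin_numE// ltey.
set b := (vol Q)^-1 * fine S.
have -> : (((vol Q)^-1)%:E * S = b%:E)%E by rewrite EFinM fineK.
rewrite poweR_EFin -EFinM lee_fin => hb.
have b0 : 0 <= b by rewrite mulr_ge0 ?fine_ge0// invr_ge0 ltW.
(* The factor 4^(p-1) in M gives lam^s >= 4 b, so the dual term is at most |Q|/4. As |E| >= |Q|/2, a
   quarter of |Q| is left for lam w(E), that is, w(E) >= w(Q) / (4 M). *)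
pose lam := M / A.
have lam0 : 0 < lam by rewrite divr_gt0.
have ls0 : 0 < lam `^ s by rewrite powR_gt0.
have KA0 : 0 <= K' / A by rewrite divr_ge0// ltW.
have blam : 4 * b <= lam `^ s.
  have : b `^ (p - 1) <= K' / A.
    rewrite ler_pdivlMr// mulrC; apply: (le_trans hb); by rewrite le_max lexx.
  move=> /(ge0_ler_powR (ltW s0)); rewrite !nnegrE powR_ge0 KA0 => /(_ isT isT).
  rewrite -powRrM mulfV ?gt_eqF// powRr1// => hb'.
  have -> : lam = 4 `^ (p - 1) * (K' / A) by rewrite /lam /M mulrCA mulrA mulrC mulrA.
  rewrite powRM ?powR_ge0 ?KA0// -powRrM mulfV ?gt_eqF// powRr1//.
  by rewrite ler_wpM2l.
have : (mu E <= lam%:E * \int[mu]_(x in E) (w x)%:E + ((lam `^ s)^-1)%:E * S)%E.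
  have -> : mu E = (\int[mu]_(x in E) (cst 1%E x))%E by rewrite integral_cst// mul1e.
  apply: (@le_trans _ _ (\int[mu]_(x in E) (lam%:E * (w x)%:E +
      ((lam `^ s)^-1)%:E * (w x `^ (- s))%:E))%E).
    apply: ae_ge0_le_integral => //.
    - move=> x _; rewrite adde_ge0// mule_ge0// ?lee_fin ?invr_ge0 ?powR_ge0//.
      exact: ltW.
    - by apply: emeasurable_funD; apply: measurable_funeM; [exact: mw' | exact: msg].
    (* Positivity of w is essential: at a zero of w the power with exponent -s takes the default
       value 0, and the pointwise bound fails. *)
    - apply: filterS wae => x wx _.
      rewrite -!EFinM -EFinD lee_fin powRN -invfM -powRM ?(ltW lam0) ?(ltW wx)//.
      by apply: one_le_add_powRN; [exact: mulr_gt0 | exact: ltW].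
  have il0 : 0 <= (lam `^ s)^-1 by rewrite invr_ge0 powR_ge0.
  have wE0 x : E x -> (0 <= (w x)%:E)%E by rewrite lee_fin.
  have sE0 x : E x -> (0 <= (w x `^ (- s))%:E)%E by rewrite lee_fin powR_ge0.
  have lwE0 x : E x -> (0 <= lam%:E * (w x)%:E)%E.
    by rewrite mule_ge0// lee_fin// ltW.
  have lsE0 x : E x -> (0 <= ((lam `^ s)^-1)%:E * (w x `^ (- s))%:E)%E.
    by rewrite mule_ge0// lee_fin// powR_ge0.
  rewrite ge0_integralD//; [|by apply: measurable_funeM..].
  rewrite !ge0_integralZl_EFin ?(ltW lam0)//.
  apply: leeD => //; apply: lee_wpmul2l; first by rewrite lee_fin invr_ge0 powR_ge0.
  apply: ge0_subset_integral => //.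
  by move=> x _; rewrite lee_fin powR_ge0.
move: muE; rewrite -(fineK fi) -(fineK fE) -(fineK fS) -!EFinM -EFinD !lee_fin => muE h.
set I := fine (\int[mu]_(x in E) _)%E in h *.
have sb : fine S = vol Q * b by rewrite /b mulrA divff ?gt_eqF// mul1r.
have h2 : (lam `^ s)^-1 * fine S <= vol Q / 4.
  rewrite sb mulrC -mulrA; apply: ler_wpM2l; first exact: ltW.
  rewrite ler_pdivrMr//; lra.
have h3 : vol Q / 4 <= lam * I by lra.
rewrite invfM mulrC mulrA ler_pdivrMr//.
have : A * (vol Q / 4) <= A * (lam * I) by apply: ler_wpM2l => //; exact: ltW.
have -> : A * (lam * I) = I * M by rewrite mulrA [A * _]mulrC divfK ?gt_eqF// mulrC.
have -> // : A * (vol Q / 4) = W / 4.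
by rewrite /A mulrAC mulrA mulVf ?gt_eqF// mul1r mulrC.
Qed.

Lemma Ainf_thin : Ainf mu w -> exists2 g : R, 0 <= g < 1 &
  forall (Q : cube R n) E, measurable E -> E `<=` cset Q ->
  (mu E <= (vol Q / 2)%:E)%E -> (\int[mu]_(x in E) (w x)%:E <= g%:E * wmeas mu w Q)%E.
Proof.
move=> [_ [p [p1 Apw]]].
have [c [/andP[c0 c1] thick]] : exists c, 0 < c <= 1 /\ thick_bound c.
  move: p1; rewrite le_eqVlt => /orP[/eqP e|p1]; last exact: Ap_thick Apw.
  by apply: Ap1_thick; rewrite e.
exists (1 - c); first by apply/andP; split; lra.
by move=> Q E mE EQ muE; apply: thin_of_thick => //; exact: ltW.
Qed.

End weights.

(** * From exponential integrals to the Orlicz norms *)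

Section conclusion.
Variables (R : realType) (n : nat) (mu : {measure set (n.-tuple R) -> \bar R}).
Variables (p : R) (B : cube R n -> (n.-tuple R -> R) -> (n.-tuple R -> R)).
Variables (alpha beta : nat -> R).
Hypothesis lmu : is_lebesgue mu.
Hypothesis p1 : 1 <= p.
Hypothesis BO : classO mu p B alpha beta.

Lemma sum_alpha_fin : exists2 A : R, 0 <= A & (\sum_(2 <= k <oo) (alpha k)%:E <= A%:E)%E.
Proof.
have [_ [_ [_ [a0 [afin _]]]]] := BO.
have s0 : (0 <= \sum_(2 <= k <oo) (alpha k)%:E)%E.
  by apply: nneseries_ge0 => k _ _; rewrite lee_fin.
have fs : (\sum_(2 <= k <oo) (alpha k)%:E < +oo)%E.
  apply: le_lt_trans afin; apply: lee_nneseries => [k _ _|k _]; rewrite lee_fin//.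
  rewrite ler_peMl// -[leLHS](powRr0 2) ler_powR ?ler1n//.
  by rewrite divr_ge0 ?mulr_ge0// (le_trans _ p1).
exists (fine (\sum_(2 <= k <oo) (alpha k)%:E)%E); first exact: fine_ge0.
by rewrite fineK// ge0_fin_numE.
Qed.

Variable w : n.-tuple R -> R.
Hypothesis ww : weight mu w.
Variable gam : R.
Hypothesis gam01 : 0 <= gam < 1.
Hypothesis wgam : forall (Q : cube R n) E, measurable E -> E `<=` cset Q ->
  (mu E <= (vol Q / 2)%:E)%E -> (\int[mu]_(x in E) (w x)%:E <= gam%:E * wmeas mu w Q)%E.

Lemma expLwnorm_le (D : R) : 1 <= D ->
  exists C : R, 0 < C /\
     forall (f : n.-tuple R -> R) (a : cube R n -> R),
       locLp mu p f -> Dinf D a ->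
       (forall (k : nat) (Q : cube R n),
          (avgp mu p (dil k Q) (B Q f) <= (a (dil k Q))%:E)%E) ->
       forall Q : cube R n,
         (expLwnorm mu w Q (B Q f)
            <= C%:E * \sum_(1 <= k <oo) ((eta_seq alpha k)%:E * (a (dil k Q))%:E))%E.
Proof.
move=> D1; have [A A0 lA] := sum_alpha_fin.
have lr0 : 0 < ln (2 / (1 + gam)).
  by have /andP[? ?] := gam01; rewrite ln_gt0// ltr_pdivlMr; lra.
pose C := jump_const n D A / ln (2 / (1 + gam)).
have C0 : 0 < C by rewrite divr_gt0// jump_const_gt0.
exists C; split => // f a lf aD af Q.
set lam := (\sum_(1 <= k <oo) _)%E.
have a0 := BO.2.2.2.1.
have lam0 : (0 <= lam)%E.
  apply: nneseries_ge0 => k _ _; rewrite mule_ge0// lee_fin; last exact: aD.1.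
  by rewrite /eta_seq; case: ifP => // _; case: ifP => // _; rewrite le_max a0.
have [lamy|lamfin] := eqVneq lam +oo%E; first by rewrite lamy gt0_muley ?leey.
have {}lamfin : lam \is a fin_num by rewrite ge0_fin_numE// ltey.
apply/lee_addgt0Pr => e e0.
(* The series may vanish, while the recursion needs L > 0. The increment e / C raises the scale by
   exactly e, which is then arbitrary. *)
set L := fine lam + e / C.
have L0 : 0 < L by rewrite ltr_wpDl ?fine_ge0// divr_gt0.
have lL : (lam <= L%:E)%E by rewrite -(fineK lamfin) lee_fin lerDl divr_ge0// ltW.
have -> : (C%:E * lam + e%:E = (exp_scale n D L A gam)%:E)%E.
  rewrite -(fineK lamfin) -EFinM -EFinD; congr EFin.
  by rewrite /exp_scale -/C -mulrA -/C /L mulrDl divfK ?gt_eqF// mulrC.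
apply: ereal_inf_lbound; exists (exp_scale n D L A gam) => //; split.
  exact: exp_scale_gt0.
have W0 := wmeas_gt0 lmu ww Q.
have fW : wmeas mu w Q \is a fin_num by rewrite ge0_fin_numE ?ltW// ww.2.2.1.
rewrite lee_pdivrMl ?fine_gt0 ?W0 ?ww.2.2.1// mule1 fineK//.
exact: (exp_integral_le lmu p1 BO D1 lf aD af L0 lL A0 lA ww.1 ww.2.1 ww.2.2.1
  gam01 wgam (wmeas_gt0 lmu ww)).
Qed.

End conclusion.

Section unweighted.
Variables (R : realType) (n : nat) (mu : {measure set (n.-tuple R) -> \bar R}).
Hypothesis lmu : is_lebesgue mu.

Lemma wmeas_cst1 Q : wmeas mu (cst 1) Q = (vol Q)%:E.
Proof.
rewrite -lmu -[RHS]mul1e -integral_cst//; exact: measurable_cset.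
Qed.

Lemma weight_cst1 : weight mu (cst 1).
Proof.
split; first exact: measurable_cst.
split => //; split; first by move=> Q; rewrite wmeas_cst1 ltry.
exact: aeW.
Qed.

Lemma expLwnorm_cst1 Q g : expLwnorm mu (cst 1) Q g = expLnorm mu Q g.
Proof.
rewrite /expLwnorm /expLnorm wmeas_cst1 /=; congr ereal_inf.
by under eq_fun do under eq_integral do rewrite mulr1.
Qed.

End unweighted.

Theorem mainTheorem8 (R : realType) (n : nat)
    (mu : {measure set (n.-tuple R) -> \bar R}) (p0 : R)
    (B : cube R n -> (n.-tuple R -> R) -> (n.-tuple R -> R))
    (alpha beta : nat -> R) :
  (0 < n)%N -> is_lebesgue mu -> 1 <= p0 -> classO mu p0 B alpha beta ->
  forall D : R, 1 <= D ->
  (exists C : R, 0 < C /\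
     forall (f : n.-tuple R -> R) (a : cube R n -> R),
       locLp mu p0 f -> Dinf D a ->
       (forall (k : nat) (Q : cube R n),
          (avgp mu p0 (dil k Q) (B Q f) <= (a (dil k Q))%:E)%E) ->
       forall Q : cube R n,
         (expLnorm mu Q (B Q f)
            <= C%:E * \sum_(1 <= k <oo) ((eta_seq alpha k)%:E * (a (dil k Q))%:E))%E) /\
  (forall w : n.-tuple R -> R, Ainf mu w ->
   exists Cw : R, 0 < Cw /\
     forall (f : n.-tuple R -> R) (a : cube R n -> R),
       locLp mu p0 f -> Dinf D a ->
       (forall (k : nat) (Q : cube R n),
          (avgp mu p0 (dil k Q) (B Q f) <= (a (dil k Q))%:E)%E) ->
       forall Q : cube R n,
         (expLwnorm mu w Q (B Q f)
            <= Cw%:E * \sum_(1 <= k <oo) ((eta_seq alpha k)%:E * (a (dil k Q))%:E))%E).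
Proof.
move=> _ lmu p1 BO D D1; split; last first.
  move=> w Aw; have [g g01 thin] := Ainf_thin lmu Aw.1 Aw.
  exact: (expLwnorm_le lmu p1 BO Aw.1 g01 thin D1).
(* For the weight 1 the small-set bound is the assumption |E| <= |Q|/2 itself, with constant 1/2. *)
have half : 0 <= (1 / 2 : R) < 1 by apply/andP; split; lra.
have thin (Q : cube R n) E : measurable E -> E `<=` cset Q ->
    (mu E <= (vol Q / 2)%:E)%E ->
    (\int[mu]_(x in E) (cst 1%R x)%:E <= (1 / 2)%:E * wmeas mu (cst 1%R) Q)%E.
  move=> mE _ muE; rewrite wmeas_cst1// -EFinM mul1r mulrC.
  by rewrite (_ : (fun x => _) = cst 1%E)// integral_cst// mul1e.
have [C [C0 hC]] := expLwnorm_le lmu p1 BO (weight_cst1 lmu) half thin D1.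
exists C; split => // f a lf aD af Q.
by rewrite -expLwnorm_cst1//; exact: hC.
Qed.
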